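(* Let $q_1,q_2>0$ with $Q:=q_1^{-1}+q_2^{-1}\in(1,2)$, let $\rho(t):=|t_1|^{q_1}+|t_2|^{q_2}$, $t\in\mathbb{R}^2$, and let $B$ be a real nondegenerate $2\times2$ matrix. For $i=1,2$, let $g_i:\mathbb{Z}^2\to\mathbb{R}$ satisfy $$g_i(t)=\rho(Bt)^{-1}\big(L_i(Bt)+o(1)\big),\quad|t|\to\infty,$$ where $L_i:\mathbb{R}^2_0\to\mathbb{R}$ is of the form $$L_i(u)=L_{i,+}\big(u_1/\rho(u)^{1/q_1}\big)\mathbf 1(u_2\ge0)+L_{i,-}\big(u_1/\rho(u)^{1/q_1}\big)\mathbf 1(u_2<0),\quad u\in\mathbb{R}^2_0,$$ with $L_{i,\pm}:[-1,1]\to\mathbb{R}$ continuous, $L_{i,+}(1)=L_{i,-}(1)$, $L_{i,+}(-1)=L_{i,-}(-1)$. Let $a_{\infty,i}(t):=\rho(t)^{-1}L_i(t)$, $t\in\mathbb{R}^2_0$, $i=1,2$. Then $$[g_1\star g_2](t)=\tilde\rho(Bt)^{-1}\big(\tilde L(Bt)+o(1)\big),\quad|t|\to\infty,$$ where $\tilde\rho(t):=|t_1|^{\tilde q_1}+|t_2|^{\tilde q_2}$, $t\in\mathbb{R}^2$, with $\tilde q_i:=q_i(2-Q)$, $i=1,2$, and $$\tilde L(t):=|\det B|^{-1}(a_{\infty,1}\star a_{\infty,2})\big(t_1/\tilde\rho(t)^{1/\tilde q_1},\,t_2/\tilde\rho(t)^{1/\tilde q_2}\big),\quad t\in\mathbb{R}^2_0,$$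 is a generalized invariant function with respect to $(\tilde q_1,\tilde q_2)$, i.e. for any $t\in\mathbb{R}^2_0$ the function $\lambda\mapsto\tilde L(\lambda^{1/\tilde q_1}t_1,\lambda^{1/\tilde q_2}t_2)$ is constant on $(0,\infty)$. Moreover, if $L_1=L_2\ge0$ then $\tilde L$ is strictly positive.
   Context: $\mathbb{R}^2_0=\mathbb{R}^2\setminus\{(0,0)\}$, $|t|=|t_1|+|t_2|$, and $\mathbf 1(\cdot)$ is an indicator. Discrete convolution of $g_1,g_2:\mathbb{Z}^2\to\mathbb{R}$: $[g_1\star g_2](t):=\sum_{u\in\mathbb{Z}^2}g_1(u)g_2(u+t)$, $t\in\mathbb{Z}^2$. Continuous convolution: $(a_1\star a_2)(t):=\int_{\mathbb{R}^2}a_1(u)a_2(u+t)\,\mathrm{d}u$, $t\in\mathbb{R}^2_0$.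
   Formalization: In the last clause, L_1 = L_2 ≥ 0 is additionally assumed not to be identically zero on R^2_0, since for L_1 = L_2 = 0 (e.g. g_1 = g_2 = 0) one has L̃ = 0, which is not strictly positive. *)

(* Defs.v *)
From HB Require Import structures.
From mathcomp Require Import all_boot all_order all_algebra.
From mathcomp Require Import all_classical all_reals all_analysis.
Import Order.TTheory GRing.Theory Num.Theory.
Import numFieldNormedType.Exports.

Set Implicit Arguments.
Unset Strict Implicit.
Unset Printing Implicit Defensive.

Local Open Scope classical_set_scope.
Local Open Scope ring_scope.

Definition norm1 (t : int * int) : int := `|t.1| + `|t.2|.

(* The filter of "|t| -> oo" on Z^2. *)
Definition Z2infty : set_system (int * int) :=
  filter_from setT (fun M : int => [set t | M < norm1 t]).

Global Instance Z2infty_filter : ProperFilter Z2infty.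
Proof.
apply: filter_from_proper.
  apply: filter_from_filter; first by exists 0.
  move=> M N _ _; exists (Num.max M N) => // t /=.
  by rewrite gt_max => /andP[].
move=> M _; exists (`|M| + 1, 0) => /=.
rewrite /norm1 /= normr0 addr0 ger0_norm ?addr_ge0//.
by rewrite (le_lt_trans (ler_norm M))// ltrDl.
Qed.

Section definitions.
Context {R : realType}.
Implicit Types (B : 'M[R]_2) (u t : R * R).

Definition Z2R (t : int * int) : R * R := (t.1%:~R, t.2%:~R).

(* The product B u, with points of the plane represented as pairs. *)
Definition mulMp B u : R * R :=
  (B 0 0 * u.1 + B 0 1 * u.2, B 1 0 * u.1 + B 1 1 * u.2).

Definition rho (q1 q2 : R) u : R := `|u.1| `^ q1 + `|u.2| `^ q2.

(* Only the values at u != 0 are meaningful; Lp and Lm are only evaluated on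
   [-1, 1]. *)
Definition angular (q1 q2 : R) (Lp Lm : R -> R) u : R :=
  Lp (u.1 / rho q1 q2 u `^ q1^-1) * (0 <= u.2)%R%:R +
  Lm (u.1 / rho q1 q2 u `^ q1^-1) * (u.2 < 0)%R%:R.

Definition angular_pair (Lp Lm : R -> R) : Prop :=
  [/\ {within `[-1, 1], continuous Lp}, {within `[-1, 1], continuous Lm},
      Lp 1 = Lm 1 & Lp (-1) = Lm (-1)].

(* g(t) = rho(Bt)^-1 (L(Bt) + o(1)) as |t| -> oo. *)
Definition asymp B (q1 q2 : R) (L : R * R -> R) (g : int * int -> R) : Prop :=
  exists2 r : int * int -> R, r t @[t --> Z2infty] --> (0 : R) &
    \forall t \near Z2infty,
      g t = (rho q1 q2 (mulMp B (Z2R t)))^-1 * (L (mulMp B (Z2R t)) + r t).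

(* The sum over Z^2 is the difference of the sums of the positive and negative
   parts of the terms; it is meaningful under dconv_summable. *)
Definition dconv_term (g1 g2 : int * int -> R) (t u : int * int) : \bar R :=
  (g1 u * g2 (u + t))%:E.

Definition dconv_summable (g1 g2 : int * int -> R) (t : int * int) : Prop :=
  summable setT (dconv_term g1 g2 t).

Definition dconv (g1 g2 : int * int -> R) (t : int * int) : R :=
  fine (\esum_(u in setT) (dconv_term g1 g2 t)^\+ u -
        \esum_(u in setT) (dconv_term g1 g2 t)^\- u)%E.

Definition lebesgue2 := ((@lebesgue_measure R) \x (@lebesgue_measure R))%E.

(* Values of a1 and a2 at the origin do not matter. *)
Definition cconv_integrable (a1 a2 : R * R -> R) t : Prop :=
  lebesgue2.-integrable setT (fun u => (a1 u * a2 (u + t))%:E).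

Definition cconv (a1 a2 : R * R -> R) t : R :=
  \int[lebesgue2]_(u in setT) (a1 u * a2 (u + t)).

Definition a_infty (q1 q2 : R) (L : R * R -> R) u : R := (rho q1 q2 u)^-1 * L u.

Definition generalized_invariant (q1 q2 : R) (f : R * R -> R) : Prop :=
  forall t, t != 0 -> forall lam mu : R, 0 < lam -> 0 < mu ->
    f (lam `^ q1^-1 * t.1, lam `^ q2^-1 * t.2) =
    f (mu `^ q1^-1 * t.1, mu `^ q2^-1 * t.2).

(* q1' and q2' play the role of q1 (2 - Q) and q2 (2 - Q). *)
Definition Ltilde B (q1' q2' : R) (a1 a2 : R * R -> R) t : R :=
  `|\det B|^-1 *
  cconv a1 a2 (t.1 / rho q1' q2' t `^ q1'^-1, t.2 / rho q1' q2' t `^ q2'^-1).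

End definitions.

(* Main.v *)
Require Import Defs.
From mathcomp Require Import all_boot all_order all_algebra.
From mathcomp Require Import all_classical all_reals all_analysis.
From mathcomp Require Import measurable_realfun zify ring lra.
Import Order.TTheory GRing.Theory Num.Theory.
Import numFieldNormedType.Exports.
Local Open Scope classical_set_scope.
Local Open Scope ring_scope.

(** Let [dil m w] be the point with coordinates m^(1/q1) w1 and m^(1/q2) w2.
Then rho (dil m w) = m rho w, the map [dil m] multiplies areas by m^Q, and
L1, L2 are invariant under it. For t in Z^2 put lam = rho~ (B t),
m = lam^(1/(2-Q)) and s = dil m^-1 (B t); the point s lies on the curve
rho~ = 1, and it is the point at which the definition of L~ (B t) evaluates the
continuous convolution.

The sum defining (g1 * g2)(t) is the integral of a function that is constant on
unit squares. The substitution v = B^-1 (dil m w) turns it into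
[[
  lam (g1 * g2)(t) = |det B|^-1 \int G1(w) G2(w + s) dw,
  G_i(w) = m g_i (lat m w),
]]
where [lat m w] is the integer part of B^-1 (dil m w): the area factor m^Q and
lam = m^(2-Q) leave one factor m for each g_i, and the translation by t in the
second factor becomes a translation by s ([esum_lat], [lat_shift],
[dconv_integral]). The hypothesis on g_i says that G_i(w) tends to a_i(w) as m
tends to infinity, for each w != 0 ([lat_rescaled_cvg]), and gives
|G_i(w)| <= C / rho(w) ([rescaled_bound]).

It remains to pass to the limit under the integral, uniformly in s. The
difference of the two integrands is at most
[[
  |G1 - a1|(w) C / rho(w + s) + M / rho(w) |G2 - a2|(w + s),
]]
so everything reduces to integrals of |G_i - a_i|(w) / rho(w +- s). Here
1 / rho(w + s) is replaced by a bound that does not move with s: it is at most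
C_d / (1 + rho w) where rho(w + s) > d, while the region rho(w + s) <= d, on
which |G_i - a_i| is bounded, contributes at most a constant times the integral
of 1 / rho over rho <= d ([shifted_kernel_le]). The latter is d^(Q-1) times a
finite number, small because Q > 1. The former is handled by dominated
convergence with the majorant C / (rho (1 + rho)), which is integrable near 0
because Q > 1 and at infinity because Q < 2 ([integral_rho_weight_lty]).

If L1 = L2 >= 0 is not identically zero, it is positive on a nonempty open set
that is invariant under all the maps [dil m]. Moving a point of this set far
away by [dil m] makes the translation by s negligible, so that the integrand
a1(w) a2(w + s) is positive at some point and, by continuity, around it
([cconv_gt0]). *)

Set Implicit Arguments.
Unset Strict Implicit.
Unset Printing Implicit Defensive.

(** * Linear changes of variables in the plane *)

Local Notation leb R := (@lebesgue_measure R).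
Local Notation leb2 R := (@lebesgue2 R).

Section affine1.
Context {R : realType}.

Lemma measurable_affine1 (a b : R) :
  measurable_fun setT (fun x : measurableTypeR R => a * x + b : measurableTypeR R).
Proof.
apply: measurable_funD => //; exact: measurable_funM.
Qed.

(** A measure on the line is determined by its values on the intervals
]c, d]; there both sides are computed explicitly. *)
Lemma lebesgue_preimage_affine (a b : R) (A : set (measurableTypeR R)) :
  a != 0 -> measurable A ->
  leb R ((fun x => a * x + b) @^-1` A) = (`|a|^-1%:E * leb R A)%E.
Proof.
move=> a0 mA.
have a0' : 0 < `|a| by rewrite normr_gt0.
pose phi : measurableTypeR R -> measurableTypeR R := fun x => a * x + b.
have mphi : measurable_fun setT phi by exact: measurable_affine1.
pose m' := mscale (NngNum (ltW a0')) (pushforward (leb R) phi).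
have H : leb R A = m' mphi A.
  apply: lebesgue_measure_unique => // X [[c d]] _ <-.
  rewrite /m'/= /mscale/= /pushforward/=.
  rewrite lebesgue_measure_itv/=.
  have [ap|an] := ltP 0 a.
    have -> : phi @^-1` `]c, d] = `](c - b) / a, (d - b) / a]%classic.
      apply/seteqP; split => x; rewrite /= !in_itv/= /phi.
        by rewrite ltr_pdivrMr// ler_pdivlMr// ltrBlDr lerBrDr (mulrC x).
      by rewrite ltr_pdivrMr// ler_pdivlMr// ltrBlDr lerBrDr (mulrC x).
    rewrite lebesgue_measure_itv/= !lte_fin ltr_pM2r ?invr_gt0// ltrD2r.
    case: ifPn => _; last by rewrite mule0.
    rewrite -!EFinD -EFinM gtr0_norm//; congr EFin.
    by field.
  (* For a < 0 the preimage of ]c, d] is closed on the left. *)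
  have {}an : a < 0 by rewrite lt_neqAle a0.
  have -> : phi @^-1` `]c, d] = `[(d - b) / a, (c - b) / a[%classic.
    apply/seteqP; split => x; rewrite /= !in_itv/= /phi.
      by rewrite ltr_ndivlMr// ler_ndivrMr// ltrBlDr lerBrDr (mulrC x) andbC.
    by rewrite ltr_ndivlMr// ler_ndivrMr// ltrBlDr lerBrDr (mulrC x) andbC.
  rewrite lebesgue_measure_itv/= !lte_fin ltr_nM2r ?invr_lt0// ltrD2r.
  case: ifPn => _; last by rewrite mule0.
  rewrite -!EFinD -EFinM ltr0_norm//; congr EFin.
  by field.
rewrite H /m'/= /mscale/= /pushforward muleA -EFinM mulVf ?mul1e ?normr_eq0//.
Qed.

Lemma ge0_integral_affine (a b : R) (f : measurableTypeR R -> \bar R) : a != 0 ->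
  measurable_fun setT f -> (forall x, 0 <= f x)%E ->
  (\int[leb R]_x f (a * x + b)%R = `|a|^-1%:E * \int[leb R]_x f x)%E.
Proof.
move=> a0 mf f0.
pose phi : measurableTypeR R -> measurableTypeR R := fun x => a * x + b.
have mphi : measurable_fun setT phi by exact: measurable_affine1.
have := @ge0_integral_pushforward _ _ _ _ R phi mphi (leb R) setT f measurableT mf (fun x _ => f0 x).
rewrite preimage_setT => <-.
have a0' : 0 <= `|a|^-1 by [].
rewrite -(ge0_integral_mscale _ measurableT (NngNum a0'))//.
apply: eq_measure_integral => X mX _.
exact: lebesgue_preimage_affine.
Qed.
End affine1.

Section area.
Context {R : realType}.
Local Notation plane := (measurableTypeR R * measurableTypeR R)%type.

Lemma lebesgue2_rect (A A' : set (measurableTypeR R)) :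
  measurable A -> measurable A' -> leb2 R (A `*` A') = (leb R A * leb R A')%E.
Proof. by move=> mA mA'; exact: product_measure1E. Qed.

(** The map [phi] multiplies areas by [c]. Integrals of nonnegative functions are
used instead of areas of sets because Tonelli's theorem then reduces maps that
change one coordinate to changes of variables on the line. *)
Definition scales_area (phi : plane -> plane) (c : R) : Prop :=
  measurable_fun setT phi /\
  forall f : plane -> \bar R, measurable_fun setT f -> (forall w, 0 <= f w)%E ->
    (c%:E * \int[leb2 R]_w f (phi w) = \int[leb2 R]_w f w)%E.

Lemma scales_area_comp phi psi c d :
  scales_area phi c -> scales_area psi d -> scales_area (phi \o psi) (c * d).
Proof.
move=> [mphi phiE] [mpsi psiE]; split; first exact: measurableT_comp.
move=> f mf f0; rewrite EFinM -muleA (psiE (f \o phi)); last 2 first.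
- exact: measurableT_comp.
- by move=> w; exact: f0.
exact: phiE.
Qed.

(** For a fixed second coordinate, the map is affine in the first one, with slope
[a]. *)
Lemma scales_area_affine1 (a : R) (h : measurableTypeR R -> measurableTypeR R) :
  a != 0 -> measurable_fun setT h ->
  scales_area (fun w => (a * w.1 + h w.2, w.2)) `|a|.
Proof.
move=> a0 mh.
have mphi : measurable_fun setT (fun w : plane => (a * w.1 + h w.2, w.2) : plane).
  apply/measurable_fun_pairP; split => /=.
    apply: measurable_funD; first by apply: measurable_funM => //; exact: measurable_fst.
    by apply: measurableT_comp => //; exact: measurable_snd.
  exact: measurable_snd.
split=> // f mf f0.
rewrite /lebesgue2 fubini_tonelli2//; last exact: measurableT_comp.
rewrite [RHS]fubini_tonelli2// -ge0_integralZl//; first last.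
- by move=> y _; exact: integral_ge0.
- apply: (measurable_fun_fubini_tonelli_G (m1 := leb R) (fun w : plane => f (a * w.1 + h w.2, w.2))) => //.
  by apply: measurableT_comp mphi.
apply: eq_integral => y _; rewrite /fubini_G/=.
rewrite (@ge0_integral_affine _ a (h y) (fun x => f (x, y)))//.
  by rewrite muleA -EFinM mulfV ?mul1e ?normr_eq0.
exact: measurable_fun_pair1.
Qed.

Lemma scales_area_swap : scales_area (fun w : plane => (w.2, w.1)) 1.
Proof.
have mphi : measurable_fun setT (fun w : plane => (w.2, w.1) : plane).
  by apply/measurable_fun_pairP; split; [exact: measurable_snd|exact: measurable_fst].
split=> // f mf f0; rewrite mul1e /lebesgue2 fubini_tonelli1//; last exact: measurableT_comp.
by rewrite fubini_tonelli2.
Qed.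

Lemma scales_area_eq phi psi c d :
  scales_area phi c -> phi =1 psi -> c = d -> scales_area psi d.
Proof. by move=> + /funext <- <-. Qed.

Lemma scales_area_affine2 (a : R) (h : measurableTypeR R -> measurableTypeR R) :
  a != 0 -> measurable_fun setT h ->
  scales_area (fun w => (w.1, a * w.2 + h w.1)) `|a|.
Proof.
move=> a0 mh.
have H := scales_area_comp scales_area_swap
  (scales_area_comp (scales_area_affine1 a0 mh) scales_area_swap).
by apply: (scales_area_eq H) => //; rewrite mul1r mulr1.
Qed.

Lemma scales_area_translation (s : plane) :
  scales_area (fun w => (w + s)%R) 1.
Proof.
have H := scales_area_comp
  (scales_area_affine1 (@oner_neq0 R) (measurable_cst (s.1 : measurableTypeR R)))
  (scales_area_affine2 (@oner_neq0 R) (measurable_cst (s.2 : measurableTypeR R))).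
apply: (scales_area_eq H); last by rewrite normr1 mulr1.
by move=> [x y] /=; rewrite !mul1r; case: s {H}.
Qed.

Lemma scales_area_diag (a b : R) : a != 0 -> b != 0 ->
  scales_area (fun w => (a * w.1, b * w.2)) (`|a| * `|b|).
Proof.
move=> a0 b0.
have H := scales_area_comp
  (scales_area_affine1 a0 (measurable_cst (0 : measurableTypeR R)))
  (scales_area_affine2 b0 (measurable_cst (0 : measurableTypeR R))).
apply: (scales_area_eq H) => // -[x y] /=; by rewrite !addr0.
Qed.

Lemma det2 (B : 'M[R]_2) : \det B = B 0 0 * B 1 1 - B 0 1 * B 1 0.
Proof.
rewrite (expand_det_row _ 0) big_ord_recl big_ord1 /cofactor !det_mx11 !mxE/=.
rewrite expr0 expr1 !mul1r mulN1r mulrN.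
by congr (B _ _ * B _ _ - B _ _ * B _ _); exact: val_inj.
Qed.

(** If the upper left entry of the matrix is nonzero, elimination writes the map
as a change of the first coordinate followed by a change of the second one;
exchanging the coordinates beforehand reduces the other matrices to this case. *)
Lemma scales_area_mulMp (B : 'M[R]_2) : B \in unitmx ->
  scales_area (mulMp B) `|\det B|.
Proof.
rewrite unitmxE unitfE det2 => dB0.
have key (a b c d : R) : a != 0 -> a * d - b * c != 0 ->
    scales_area (fun w => (a * w.1 + b * w.2, c * w.1 + d * w.2)) `|a * d - b * c|.
  move=> a0 D0.
  have e0 : d - b * c / a != 0.
    rewrite -(inj_eq (mulfI a0)) mulr0 mulrBr [a * (_ / _)]mulrC divfK//.
  have ml (k : R) : measurable_fun setT (fun y : measurableTypeR R => k * y : measurableTypeR R).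
    exact: measurable_funM.
  have H := scales_area_comp (scales_area_affine2 e0 (ml (c / a)))
     (scales_area_affine1 a0 (ml b)).
  apply: (scales_area_eq H).
    by move=> [x y] /=; congr pair; field.
  by rewrite -normrM; congr Num.norm; field.
have [a0|a0] := eqVneq (B 0 0) 0; last exact: key.
move: dB0; rewrite a0 mul0r sub0r oppr_eq0 => bc0.
have b0 : B 0 1 != 0 by apply: contraNneq bc0 => ->; rewrite mul0r.
have H := scales_area_comp (key (B 0 1) 0 (B 1 1) (B 1 0) b0 _) scales_area_swap.
apply: (scales_area_eq (H _)).
- by rewrite mul0r subr0.
- by move=> [x y]; rewrite /mulMp/= a0; congr pair; ring.
- by rewrite mulr1 mul0r subr0 normrN.
Qed.

End area.

(** * The homogeneous gauge and its dilations *)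

Section rho.
Context {R : realType}.
Variables q1 q2 : R.
Hypotheses (q1_gt0 : 0 < q1) (q2_gt0 : 0 < q2).
Local Notation rho := (@rho R q1 q2).
Implicit Types u v w s : R * R.

Lemma rho_ge0 u : 0 <= rho u.
Proof. by rewrite addr_ge0 ?powR_ge0. Qed.

Lemma rho0 : rho 0 = 0.
Proof. by rewrite /rho/= normr0 !powR0 ?gt_eqF// addr0. Qed.

Lemma rho_gt0 u : u != 0 -> 0 < rho u.
Proof.
move=> u0; rewrite lt_neqAle rho_ge0 andbT eq_sym.
rewrite /rho paddr_eq0 ?powR_ge0// !powR_eq0 !normr_eq0 (gt_eqF q1_gt0) (gt_eqF q2_gt0) !andbT.
by apply: contra u0 => /andP[/eqP a /eqP b]; case: u a b => a b /= -> ->.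
Qed.

Lemma rhoN u : rho (- u) = rho u.
Proof. by rewrite /rho/= !normrN. Qed.

Lemma powR_invK (q x : R) : 0 < q -> 0 <= x -> (x `^ q) `^ q^-1 = x.
Proof. by move=> q0 x0; rewrite -powRrM mulfV ?(gt_eqF q0)// powRr1. Qed.

Lemma powRV (q x : R) : 0 <= x -> x^-1 `^ q = (x `^ q)^-1.
Proof. by move=> x0; rewrite -powR_inv1// -powRrM mulN1r powRN. Qed.

Lemma powR_le1 (q x : R) : 0 < q -> 0 <= x -> x `^ q <= 1 -> x <= 1.
Proof.
move=> q0 x0; apply: contraTT; rewrite -!ltNge => x1.
by have := gt0_ltr_powR q0 _ _ x1; rewrite powR1; apply; rewrite nnegrE.
Qed.

Lemma powR_normD (q a b : R) : 0 < q ->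
  `|a + b| `^ q <= 2 `^ q * (`|a| `^ q + `|b| `^ q).
Proof.
move=> q0; wlog ab : a b / `|b| <= `|a|.
  move=> H; have /orP[] := le_total `|b| `|a|; first exact: H.
  by rewrite addrC [_ `^ _ + _]addrC; exact: H.
apply: (@le_trans _ _ ((2 * `|a|) `^ q)).
  rewrite (ge0_ler_powR (ltW q0)) ?nnegrE ?mulr_ge0//.
  by rewrite (le_trans (ler_normD _ _))// mulr_natl mulr2n lerD2l.
by rewrite powRM// ler_wpM2l ?powR_ge0// lerDl powR_ge0.
Qed.

Definition rhoD_cst : R := 2 `^ q1 + 2 `^ q2.

Lemma rhoD_cst_gt0 : 0 < rhoD_cst.
Proof. by rewrite addr_gt0 ?powR_gt0. Qed.

(** The quasi-triangle inequality replaces subadditivity, which fails when an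
exponent exceeds 1. *)
Lemma rhoD u v : rho (u + v) <= rhoD_cst * (rho u + rho v).
Proof.
have H := powR_normD u.1 v.1 q1_gt0; have H' := powR_normD u.2 v.2 q2_gt0.
apply: (le_trans (lerD H H')); rewrite /rhoD_cst /rho.
have := powR_ge0 (`|u.1|) q1; have := powR_ge0 (`|u.2|) q2.
have := powR_ge0 (`|v.1|) q1; have := powR_ge0 (`|v.2|) q2.
have := powR_ge0 2 q1; have := powR_ge0 2 q2; nra.
Qed.

Definition dilation (m : R) w : R * R := (m `^ q1^-1 * w.1, m `^ q2^-1 * w.2).

Local Notation dil := dilation.

Lemma rho_dil m w : 0 <= m -> rho (dil m w) = m * rho w.
Proof.
move=> m0; rewrite /rho/= !normrM !(ger0_norm (powR_ge0 _ _)) !powRM ?powR_ge0//.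
by rewrite -!powRrM !mulVf ?gt_eqF// powRr1// mulrDr.
Qed.

Lemma dilD m u v : dil m (u + v) = dil m u + dil m v.
Proof. by rewrite /dil/= !mulrDr. Qed.

Lemma dilM m n w : 0 <= m -> 0 <= n -> dil m (dil n w) = dil (m * n) w.
Proof. by move=> m0 n0; rewrite /dil/= !mulrA -!powRM. Qed.

Lemma dil1 w : dil 1 w = w.
Proof. by rewrite /dil !powR1 !mul1r; case: w. Qed.

Lemma dilVK m w : 0 < m -> dil m (dil m^-1 w) = w.
Proof. by move=> m0; rewrite dilM ?invr_ge0 ?ltW// divff ?gt_eqF// dil1. Qed.

Lemma continuous_powR_norm (q : R) : 0 < q -> continuous (fun x : R => `|x| `^ q).
Proof.
move=> q0 x; have [->|x0] := eqVneq x 0.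
  rewrite /continuous_at normr0 powR0 ?gt_eqF//.
  apply/cvgrPdist_lt => e e0.
  have d0 : 0 < e `^ q^-1 by rewrite powR_gt0.
  have eE : (e `^ q^-1) `^ q = e by rewrite -powRrM mulVf ?gt_eqF// powRr1 ?ltW.
  have /cvgrPdist_lt/(_ _ d0) : id y @[y --> (0 : R)] --> (0 : R) by exact: cvg_id.
  apply: filterS => y; rewrite !sub0r !normrN [X in _ -> X < _]ger0_norm ?powR_ge0//.
  by move=> ye; rewrite -[ltRHS]eE gt0_ltr_powR ?nnegrE ?powR_ge0.
suff : {for x, continuous ((fun y : R => y `^ q) \o (Num.norm : R -> R))} by [].
apply: continuous_comp; first exact: norm_continuous.
have nx : 0 < `|x| by rewrite normr_gt0.
apply: differentiable_continuous; apply/derivable1_diffP.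
by apply: derivable_powR; rewrite in_itv/= nx.
Qed.

Lemma rho_continuous : continuous rho.
Proof.
move=> u; apply: cvgD.
  have : {for u, continuous ((fun x : R => `|x| `^ q1) \o fst)}.
    by apply: continuous_comp; [exact: cvg_fst|exact: continuous_powR_norm].
  exact.
have : {for u, continuous ((fun x : R => `|x| `^ q2) \o snd)}.
  by apply: continuous_comp; [exact: cvg_snd|exact: continuous_powR_norm].
exact.
Qed.

Local Notation plane := (measurableTypeR R * measurableTypeR R)%type.

Lemma measurable_rho : measurable_fun setT (rho : plane -> R).
Proof.
apply: measurable_funD.
  apply: (@measurableT_comp _ _ _ _ _ _ (fun x : R => x `^ q1)); first exact: measurable_powR.
  apply: measurableT_comp; first exact: normr_measurable.
  exact: measurable_fst.
apply: (@measurableT_comp _ _ _ _ _ _ (fun x : R => x `^ q2)); first exact: measurable_powR.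
apply: measurableT_comp; first exact: normr_measurable.
exact: measurable_snd.
Qed.

(** The convention 0^-1 = 0 makes x^-1 the power of x with exponent -1, for all
nonnegative x. *)
Lemma measurable_invr_ge0 d (T : measurableType d) (f : T -> R) :
  (forall x, 0 <= f x) -> measurable_fun setT f -> measurable_fun setT (fun x => (f x)^-1).
Proof.
move=> f0 mf; rewrite (_ : (fun x => _) = (fun x => f x `^ (-1))).
  by apply: (@measurableT_comp _ _ _ _ _ _ (fun x : R => x `^ (-1))); first exact: measurable_powR.
by apply/funext => x; rewrite powR_inv1.
Qed.

Lemma scales_area_dil m : 0 < m ->
  scales_area (dil m : plane -> plane) (m `^ (q1^-1 + q2^-1)).
Proof.
move=> m0; apply: (scales_area_eq (@scales_area_diag _ (m `^ q1^-1) (m `^ q2^-1) _ _)) => //.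
- by rewrite gt_eqF ?powR_gt0.
- by rewrite gt_eqF ?powR_gt0.
- by rewrite !ger0_norm ?powR_ge0// -powRD// (gt_eqF m0) implybT.
Qed.

End rho.

(** * Integrability of powers of the gauge *)

Section integrability.
Context {R : realType}.
Variables q1 q2 : R.
Hypotheses (q1_gt0 : 0 < q1) (q2_gt0 : 0 < q2).
Local Notation Q := (q1^-1 + q2^-1).
Hypotheses (Q_gt1 : 1 < Q) (Q_lt2 : Q < 2).
Local Notation rho := (@rho R q1 q2).
Local Notation dil := (@dilation R q1 q2).
Local Notation plane := (measurableTypeR R * measurableTypeR R)%type.

Lemma measurable_rho_le r : measurable_fun setT (fun w : plane => (rho w <= r)%R%:R : R).
Proof.
have H : measurable [set w : plane | (rho w <= r)%R].
  rewrite -[X in measurable X]setTI.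
  have := @measurable_rho R q1 q2 measurableT `]-oo, r]%classic (measurable_itv _).
  by rewrite (_ : _ @^-1` _ = [set w : plane | (rho w <= r)%R]).
suff -> : (fun w : plane => (rho w <= r)%R%:R : R) = \1_[set w : plane | (rho w <= r)%R].
  exact: measurable_indic.
by apply/funext => w; rewrite indicE /in_mem/= /mem/= /in_set/= asboolb.
Qed.

Definition unit_area := (\int[leb2 R]_w ((rho w <= 1)%R%:R)%:E)%E.

Lemma rho_le1 (w : R * R) : rho w <= 1 -> `|w.1| <= 1 /\ `|w.2| <= 1.
Proof.
move=> w1; split.
  by apply: (powR_le1 q1_gt0) => //; apply: le_trans w1; rewrite lerDl powR_ge0.
by apply: (powR_le1 q2_gt0) => //; apply: le_trans w1; rewrite lerDr powR_ge0.
Qed.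

Lemma unit_area_lty : (unit_area < +oo)%E.
Proof.
pose I1 : set (measurableTypeR R) := `[-1, 1]%classic.
have mI1 : measurable I1 by exact: measurable_itv.
have eI1 : leb R I1 = 2%:E.
  by rewrite lebesgue_measure_itv/= lte_fin (_ : -1 < 1 :> R)// -EFinB opprK.
pose S : set plane := I1 `*` I1.
have mS : measurable S by exact: measurableX.
apply: (@le_lt_trans _ _ (\int[leb2 R]_w (\1_S w)%:E)%E).
  apply: ge0_le_integral => //.
  - by apply/measurable_EFinP; exact: measurable_rho_le.
  - by apply/measurable_EFinP; exact: measurable_indic.
  - move=> w _; rewrite lee_fin indicE; have [/rho_le1[w1 w2]|//] := boolP (rho w <= 1)%R.
    by rewrite mem_set// /S/I1/= !in_itv/= -!ler_norml.
rewrite integral_indic// setIT.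
have eS : leb2 R S = (leb R I1 * leb R I1)%E by exact: lebesgue2_rect.
apply: (@le_lt_trans _ _ (leb2 R S)) => //.
by rewrite eS eI1 -EFinM ltry.
Qed.

Lemma unit_area_ge0 : (0 <= unit_area)%E.
Proof. exact: integral_ge0. Qed.

(** The set rho <= r is the image under [dil r] of the set rho <= 1. *)
Lemma area_rho_le r : 0 < r ->
  (\int[leb2 R]_w ((rho w <= r)%R%:R)%:E = (r `^ Q)%:E * unit_area)%E.
Proof.
move=> r0; have [_ H] := @scales_area_dil R q1 q2 _ r0.
rewrite -(H (fun w => ((rho w <= r)%R%:R)%:E))//; last first.
  by apply/measurable_EFinP; exact: measurable_rho_le.
congr (_ * _)%E; apply: eq_integral => w _.
by rewrite (rho_dil q1_gt0 q2_gt0 _ (ltW r0)) ger_pMr.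
Qed.

(** Of the order of 1 / rho near 0 and of 1 / rho^2 near infinity. *)
Definition rho_weight (w : R * R) : R := (rho w * (1 + rho w))^-1.

Lemma rho_weight_ge0 w : 0 <= rho_weight w.
Proof. by rewrite invr_ge0 mulr_ge0 ?addr_ge0 ?rho_ge0. Qed.

Lemma measurable_1Drho_inv : measurable_fun setT (fun w : plane => (1 + rho w)^-1 : R).
Proof.
apply: measurable_invr_ge0; first by move=> w; rewrite addr_ge0// rho_ge0.
by apply: measurable_funD => //; exact: measurable_rho.
Qed.

Lemma measurable_rho_weight : measurable_fun setT (rho_weight : plane -> R).
Proof.
apply: measurable_invr_ge0.
  by move=> w; rewrite mulr_ge0 ?addr_ge0 ?rho_ge0.
by apply: measurable_funM; [|apply: measurable_funD => //]; exact: measurable_rho.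
Qed.

Lemma dyadic_gt1 (x : R) : 1 < x -> exists n, 2 ^+ n < x <= 2 ^+ n.+1.
Proof.
move=> x1; have ex : exists n, (x <= 2 ^+ n).
  exists (Num.truncn x).+1; apply: (le_trans (ltW (truncnS_gt _))).
  by rewrite -natrX ler_nat ltnW// ltn_expl.
have := ex_minnP ex; case=> -[|m] /=.
  by rewrite expr0 leNgt x1.
move=> xm min; exists m; rewrite xm andbT ltNge; apply/negP => /min.
by rewrite ltnn.
Qed.

Lemma dyadic_le1 (x : R) : 0 < x <= 1 -> exists n, 2^-1 ^+ n.+1 < x <= 2^-1 ^+ n.
Proof.
move=> /andP[x0 x1]; move: (x1); rewrite le_eqVlt => /orP[/eqP ->|].
  by exists 0%N; rewrite expr0 expr1 lexx andbT invf_lt1 ?ltr1n.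
move=> {}x1; have ex : exists n, (2^-1 ^+ n < x).
  exists (Num.truncn x^-1).+1; rewrite exprVn invf_plt ?posrE ?exprn_gt0//.
  apply: (lt_le_trans (truncnS_gt _)).
  by rewrite -natrX ler_nat ltnW// ltn_expl.
have := ex_minnP ex; case=> -[|m] /=.
  by rewrite expr0 ltNge ltW.
move=> xm min; exists m; rewrite xm leNgt; apply/negP => /min.
by rewrite ltnn.
Qed.

(** A term of a series that majorizes the weight. The weight is at most 4^-n on
the shell 2^n < rho <= 2^(n+1) and at most 2^(n+1) on the shell
2^-(n+1) < rho <= 2^-n; the shells are enlarged to full sublevel sets of rho,
whose areas are known by scaling. *)
Definition dyadic_term n (w : R * R) : R :=
  2^-1 ^+ n * 2^-1 ^+ n * (rho w <= 2 ^+ n.+1)%R%:R +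
  2 ^+ n.+1 * (rho w <= 2^-1 ^+ n)%R%:R.

Lemma dyadic_term_ge0 n w : 0 <= dyadic_term n w.
Proof. by rewrite addr_ge0// ?mulr_ge0// ?exprn_ge0// invr_ge0. Qed.

Lemma rho_weight_le_dyadic w : exists n, rho_weight w <= dyadic_term n w.
Proof.
(* At the origin the weight is 0, because 0^-1 = 0. *)
have [->|w0] := eqVneq w 0.
  by exists 0%N; rewrite /rho_weight rho0// mul0r invr0 dyadic_term_ge0.
have r0 := rho_gt0 q1_gt0 q2_gt0 w0; have r1 : 0 < 1 + rho w by rewrite ltr_pwDr.
have [r1'|r1'] := ltP 1 (rho w).
  have [n /andP[h1 h2]] := dyadic_gt1 r1'; exists n.
  rewrite /dyadic_term h2 mulr1 (@le_trans _ _ (2^-1 ^+ n * 2^-1 ^+ n))//; last first.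
    by rewrite lerDl mulr_ge0// exprn_ge0.
  rewrite exprVn -invfM lef_pV2 ?posrE ?mulr_gt0 ?exprn_gt0//.
  apply: ler_pM; rewrite ?exprn_ge0// ltW//.
  by apply: (lt_trans h1); rewrite ltrDr.
have [|n /andP[h1 h2]] := @dyadic_le1 (rho w); first by rewrite r0.
exists n; rewrite /dyadic_term h2 mulr1 (@le_trans _ _ (2 ^+ n.+1))//; last first.
  by rewrite lerDr mulr_ge0// mulr_ge0// exprn_ge0// invr_ge0.
rewrite -[leRHS]invrK lef_pV2 ?posrE ?mulr_gt0 ?invr_gt0 ?exprn_gt0//.
rewrite -exprVn -[leLHS]mulr1; apply: ler_pM => //.
- exact: ltW.
- by rewrite lerDl ltW.
Qed.

Lemma measurable_dyadic_term n :
  measurable_fun setT (fun w : plane => (dyadic_term n w)%:E).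
Proof.
apply/measurable_EFinP; apply: measurable_funD; apply: measurable_funM => //.
  exact: (measurable_rho_le (2 ^+ n.+1)).
exact: (measurable_rho_le (2^-1 ^+ n)).
Qed.

Lemma integral_dyadic_term n :
  (\int[leb2 R]_w (dyadic_term n w)%:E =
   (2 `^ Q * (2 `^ Q / (2*2)) ^+ n + 2 * (2 / 2 `^ Q) ^+ n)%:E * unit_area)%E.
Proof.
have half0 (k : nat) : 0 <= 2^-1 ^+ k :> R by rewrite exprn_ge0// invr_ge0.
have two0 (k : nat) : 0 <= 2 ^+ k :> R by rewrite exprn_ge0.
have mr r : measurable_fun setT (fun w : plane => ((rho w <= r)%R%:R)%:E : \bar R).
  by apply/measurable_EFinP; exact: (measurable_rho_le r).
under eq_integral do rewrite EFinD !EFinM.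
rewrite ge0_integralD; last 5 first.
- exact: measurableT.
- by move=> w _; rewrite -!EFinM lee_fin !mulr_ge0.
- exact: measurable_funeM.
- by move=> w _; rewrite -!EFinM lee_fin mulr_ge0.
- exact: measurable_funeM.
rewrite ge0_integralZl//.
rewrite ge0_integralZl ?lee_fin//.
rewrite !area_rho_le ?exprn_gt0 ?invr_gt0//.
rewrite !muleA -ge0_muleDl ?lee_fin ?mulr_ge0 ?powR_ge0 ?exprn_ge0//.
congr (_%:E * _)%E.
have pX (x : R) k : 0 <= x -> (x ^+ k) `^ Q = (x `^ Q) ^+ k.
  by move=> x0; rewrite -(powR_mulrn k x0) -powRrM mulrC powRrM powR_mulrn ?powR_ge0.
have pV : 2^-1 `^ Q = (2 `^ Q)^-1 by exact: powRV.
rewrite (pX 2 n.+1) ?ler0n// (pX 2^-1 n) ?invr_ge0 ?ler0n// pV.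
rewrite !exprMn !exprVn exprMn invfM !exprS.
move: (_ `^ _) => a; ring.
Qed.

Lemma geometric_partial_sum_le (c z : R) n : 0 <= c -> 0 < z -> z < 1 ->
  \sum_(0 <= i < n) c * z ^+ i <= c / (1 - z).
Proof.
move=> c0 z0 z1; have := @geometric_le_lim R n c z c0 z0 _.
by rewrite gtr0_norm// => /(_ z1).
Qed.

(** The integrals of the dyadic terms form two geometric series, with ratios
2^(Q-2) and 2^(1-Q), both less than 1 because 1 < Q < 2. *)
Lemma integral_rho_weight_lty : (\int[leb2 R]_w (rho_weight w)%:E < +oo)%E.
Proof.
have Q2 : 2 `^ Q < 2 * 2 :> R.
  have -> : 2 * 2 = 2 `^ 2%:R :> R by rewrite powR_mulrn// expr2.
  by rewrite /powR pnatr_eq0/= ltr_expR ltr_pM2r// ln_gt0// ltr1n.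
have Q1 : 2 < 2 `^ Q :> R.
  have -> : 2 = 2 `^ 1 :> R by rewrite powRr1.
  by rewrite -powRrM mul1r /powR pnatr_eq0/= ltr_expR ltr_pM2r// ln_gt0// ltr1n.
have a0 : 0 < 2 `^ Q :> R by rewrite powR_gt0.
pose S := 2 `^ Q / (1 - 2 `^ Q / (2 * 2)) + 2 / (1 - 2 / 2 `^ Q).
apply: (@le_lt_trans _ _ (S%:E * unit_area)%E); last first.
  have := unit_area_lty; have := unit_area_ge0.
  by case: unit_area => // r _ _; rewrite -EFinM ltry.
apply: (@le_trans _ _ (\int[leb2 R]_w \sum_(0 <= n <oo) (dyadic_term n w)%:E)%E).
  apply: ge0_le_integral => //.
  - by move=> w _; rewrite lee_fin rho_weight_ge0.
  - by apply/measurable_EFinP; exact: measurable_rho_weight.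
  - apply: ge0_emeasurable_sum => [n w _ _|n _]; last exact: measurable_dyadic_term.
    by rewrite lee_fin dyadic_term_ge0.
  - move=> w _; have [n wn] := rho_weight_le_dyadic w.
    rewrite (le_trans _ (nneseries_lim_ge n.+1 _))//; last first.
      by move=> k _ _; rewrite lee_fin dyadic_term_ge0.
    rewrite sumEFin lee_fin (le_trans wn)// big_nat_recr//= lerDr.
    by apply: sumr_ge0 => i _; exact: dyadic_term_ge0.
rewrite integral_nneseries//; last 2 first.
- exact: measurable_dyadic_term.
- by move=> n w _; rewrite lee_fin dyadic_term_ge0.
apply: lime_le.
  by apply: is_cvg_nneseries => n _ _; apply: integral_ge0 => w _; rewrite lee_fin dyadic_term_ge0.
apply: nearW => n; under eq_bigr do rewrite integral_dyadic_term.
have t0 i : 0 <= 2 `^ Q * (2 `^ Q / (2*2)) ^+ i + 2 * (2 / 2 `^ Q) ^+ i :> R.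
  by rewrite addr_ge0// mulr_ge0 ?exprn_ge0 ?divr_ge0 ?powR_ge0 ?mulr_ge0.
rewrite -ge0_sume_distrl; last by move=> i _; rewrite lee_fin.
rewrite lee_wpmul2r ?unit_area_ge0// sumEFin lee_fin big_split/= lerD//.
- apply: geometric_partial_sum_le; first exact: ltW.
    by rewrite divr_gt0// mulr_gt0.
  by rewrite ltr_pdivrMr ?mul1r// mulr_gt0.
- by apply: geometric_partial_sum_le; rewrite ?divr_gt0// ltr_pdivrMr ?mul1r.
Qed.

End integrability.

(** * Translates of the kernel 1 / rho *)

Section kernel.
Context {R : realType}.
Variables q1 q2 : R.
Hypotheses (q1_gt0 : 0 < q1) (q2_gt0 : 0 < q2).
Local Notation Q := (q1^-1 + q2^-1).
Hypotheses (Q_gt1 : 1 < Q) (Q_lt2 : Q < 2).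
Local Notation rho := (@rho R q1 q2).
Local Notation dil := (@dilation R q1 q2).
Local Notation K := (rhoD_cst q1 q2).
Local Notation plane := (measurableTypeR R * measurableTypeR R)%type.

Definition rho_near (d : R) (w : R * R) : R := (rho w <= d)%R%:R * (rho w)^-1.

Lemma rho_near_ge0 d w : 0 <= rho_near d w.
Proof. by rewrite mulr_ge0// invr_ge0 rho_ge0. Qed.

Lemma measurable_rho_inv : measurable_fun setT (fun w : plane => (rho w)^-1 : R).
Proof.
by apply: measurable_invr_ge0; [move=> w; exact: rho_ge0|exact: measurable_rho].
Qed.

Lemma measurable_rho_near d : measurable_fun setT (rho_near d : plane -> R).
Proof.
by apply: measurable_funM; [exact: measurable_rho_le|exact: measurable_rho_inv].
Qed.

Lemma integral_rho_near1_lty : (\int[leb2 R]_w (rho_near 1 w)%:E < +oo)%E.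
Proof.
apply: (@le_lt_trans _ _ (\int[leb2 R]_w (2%:E * (rho_weight q1 q2 w)%:E))%E).
  apply: ge0_le_integral => //.
  - by move=> w _; rewrite lee_fin rho_near_ge0.
  - by apply/measurable_EFinP; exact: measurable_rho_near.
  - by apply/measurable_EFinP; apply: measurable_funM => //; exact: measurable_rho_weight.
  - move=> w _; rewrite -EFinM lee_fin /rho_near /rho_weight.
    have r0 := rho_ge0 q1 q2 w.
    have [w1|] := boolP (rho w <= 1)%R; last by rewrite mul0r mulr_ge0// invr_ge0 mulr_ge0// addr_ge0.
    rewrite mul1r invfM mulrCA ler_peMr ?invr_ge0// ler_pdivlMr ?ltr_pwDl//.
    by rewrite mul1r lerD2l.
rewrite ge0_integralZl//; last 2 first.
- by apply/measurable_EFinP; exact: measurable_rho_weight.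
- by move=> w _; rewrite lee_fin rho_weight_ge0.
by rewrite lte_mul_pinfty// integral_rho_weight_lty.
Qed.

Lemma integral_rho_near d : 0 < d ->
  (\int[leb2 R]_w (rho_near d w)%:E =
   (d `^ (Q - 1))%:E * \int[leb2 R]_w (rho_near 1 w)%:E)%E.
Proof.
move=> d0; have [_ H] := @scales_area_dil R q1 q2 _ d0.
rewrite -(H (fun w => (rho_near d w)%:E)); last 2 first.
- by apply/measurable_EFinP; exact: measurable_rho_near.
- by move=> w; rewrite lee_fin rho_near_ge0.
have -> : d `^ (Q - 1) = d `^ Q * d^-1.
  by rewrite (@powRB _ d Q 1) ?(powRr1 (ltW d0))// (gt_eqF d0) implybT.
rewrite EFinM -muleA; congr (_ * _)%E.
rewrite -ge0_integralZl//; last 3 first.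
- by apply/measurable_EFinP; exact: measurable_rho_near.
- by move=> w _; rewrite lee_fin rho_near_ge0.
- by rewrite lee_fin invr_ge0 ltW.
apply: eq_integral => w _; rewrite -EFinM; congr EFin.
rewrite /rho_near (rho_dil q1_gt0 q2_gt0 _ (ltW d0)) ger_pMr// invfM.
by rewrite mulrCA.
Qed.

(** The integral is d^(Q-1) times its value for d = 1, and Q > 1. *)
Lemma integral_rho_near_small (e d0 : R) : 0 < e -> 0 < d0 ->
  exists d, [/\ 0 < d, d <= d0 & (\int[leb2 R]_w (rho_near d w)%:E <= e%:E)%E].
Proof.
move=> e0 d0_gt0.
have [j j0 jE] : exists2 j : R, 0 <= j & (\int[leb2 R]_w (rho_near 1 w)%:E = j%:E)%E.
  have := integral_rho_near1_lty.
  have : (0 <= \int[leb2 R]_w (rho_near 1 w)%:E)%E.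
    by apply: integral_ge0 => w _; rewrite lee_fin rho_near_ge0.
  by case: (\int[leb2 R]_w _)%E => // j; rewrite lee_fin => j0 _; exists j.
(* With this choice d1 `^ (Q - 1) * j < e. *)
pose d1 := (e / (j + 1)) `^ (Q - 1)^-1.
have ej : 0 < e / (j + 1) by rewrite divr_gt0// ltr_wpDl.
have Q1 : 0 < Q - 1 by rewrite subr_gt0.
have d1_gt0 : 0 < d1 by rewrite powR_gt0.
have m0 : 0 < Num.min d0 d1 by rewrite lt_min d0_gt0.
exists (Num.min d0 d1); split => //; first by rewrite ge_min lexx.
rewrite integral_rho_near// jE -EFinM lee_fin.
have : (Num.min d0 d1) `^ (Q - 1) <= d1 `^ (Q - 1).
  rewrite (ge0_ler_powR (ltW Q1)) ?nnegrE ?(ltW m0) ?(ltW d1_gt0)//.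
  by rewrite ge_min lexx orbT.
rewrite /d1 -powRrM mulVf ?gt_eqF// powRr1 ?(ltW ej)// => h.
apply: (le_trans (ler_wpM2r j0 h)).
rewrite -mulrA ler_piMr ?(ltW e0)// mulrC ler_pdivrMr ?mul1r ?lerDl//.
by rewrite ltr_wpDl.
Qed.

(** Where rho (w + s) <= d, the point w is near - s and hence away from 0, so that
E w is bounded; elsewhere rho (w + s) is at least a constant times 1 + rho w.
The two terms on the right serve different purposes: the first one is small with
d, whatever E is, and the second one has a weight that is independent of s. *)
Lemma shifted_kernel_le (E : R * R -> R) (C c M d : R) (s w : R * R) :
  0 <= C -> 0 < c -> c <= rho s -> rho s <= M -> 0 < d -> d <= c / (2 * K) ->
  0 <= E w -> (w != 0 -> E w <= C / rho w) ->
  E w / rho (w + s) <=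
    (2 * K * C / c) * rho_near d (w + s) +
    ((1 + K * M) / d + K) * (E w / (1 + rho w)).
Proof.
move=> C0 c0 cs sM d0 dc E0 EC.
have K0 := rhoD_cst_gt0 q1 q2.
have M0 : 0 <= M by rewrite (le_trans _ sM)// (le_trans (ltW c0)).
have r1 : 0 < 1 + rho w by rewrite ltr_pwDl// rho_ge0.
have [near|far] := leP (rho (w + s)) d.
- rewrite /rho_near near mul1r.
  apply: (@le_trans _ _ ((2 * K * C / c) / rho (w + s))); last first.
    rewrite lerDl mulr_ge0 ?addr_ge0 ?divr_ge0 ?addr_ge0 ?mulr_ge0//; exact: ltW.
  rewrite ler_wpM2r ?invr_ge0 ?rho_ge0//.
  (* c <= K * (rho (w + s) + rho w), where rho (w + s) uses up at most c / 2. *)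
  have wge : c / (2 * K) <= rho w.
    have := rhoD q1_gt0 q2_gt0 (w + s) (- w).
    rewrite addrAC subrr add0r rhoN => h.
    have {}h : c <= K * (d + rho w).
      by apply: (le_trans cs); apply: (le_trans h); rewrite (ler_wpM2l (ltW K0))// lerD2r.
    have : c <= K * (c / (2 * K) + rho w).
      by apply: (le_trans h); rewrite (ler_wpM2l (ltW K0))// lerD2r.
    have -> : K * (c / (2 * K) + rho w) = c / 2 + K * rho w by field; rewrite gt_eqF.
    rewrite ler_pdivrMr ?mulr_gt0//; lra.
  have w0 : w != 0.
    apply: contraTneq wge => ->; rewrite rho0// -ltNge divr_gt0// mulr_gt0//.
  apply: (le_trans (EC w0)).
  have rw0 := rho_gt0 q1_gt0 q2_gt0 w0.
  rewrite ler_pdivrMr// mulrAC -[leLHS]mulr1 -!mulrA.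
  rewrite [leRHS](_ : _ = C * ((2 * K) * rho w / c)); last by field; rewrite gt_eqF.
  rewrite ler_wpM2l// ler_pdivlMr// mul1r mulrC -ler_pdivrMr ?mulr_gt0//.
- have rws : 0 < rho (w + s) by rewrite (lt_trans d0).
  apply: (@le_trans _ _ (((1 + K * M) / d + K) * (E w / (1 + rho w)))); last first.
    by rewrite lerDr mulr_ge0 ?rho_near_ge0// !mulr_ge0 ?invr_ge0// ltW.
  rewrite mulrCA ler_wpM2l// ler_pdivlMr// mulrC ler_pdivrMr//.
  have h : 1 + rho w <= (1 + K * M) + K * rho (w + s).
    have := rhoD q1_gt0 q2_gt0 (w + s) (- s).
    rewrite addrK rhoN => h; rewrite -addrA lerD2l; apply: (le_trans h).
    by rewrite mulrDr [leLHS]addrC lerD2r (ler_wpM2l (ltW K0)).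
  apply: (le_trans h); rewrite [leRHS]mulrDl lerD2r -mulrA ler_peMr//.
    by rewrite addr_ge0// mulr_ge0// ltW.
  by rewrite mulrC ler_pdivlMr// mul1r ltW.
Qed.

Lemma integral_shifted_kernel_le (E : plane -> R) (C c M d : R) (s : plane) :
  measurable_fun setT E -> (forall w, 0 <= E w) -> (forall w, w != 0 -> E w <= C / rho w) ->
  0 <= C -> 0 < c -> c <= rho s -> rho s <= M -> 0 < d -> d <= c / (2 * K) ->
  (\int[leb2 R]_w (E w / rho (w + s))%:E <=
    (2 * K * C / c)%:E * \int[leb2 R]_w (rho_near d w)%:E +
    ((1 + K * M) / d + K)%:E * \int[leb2 R]_w (E w / (1 + rho w))%:E)%E.
Proof.
move=> mE E0 EC C0 c0 cs sM d0 dc.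
have K0 := rhoD_cst_gt0 q1 q2.
have M0 : 0 <= M by rewrite (le_trans _ sM)// (le_trans (ltW c0)).
have [mt Ht] := scales_area_translation s.
have mn : measurable_fun setT (fun w : plane => (rho_near d (w + s))%:E).
  apply/measurable_EFinP.
  by apply: (measurableT_comp (f := rho_near d : plane -> R)); [exact: measurable_rho_near|exact: mt].
have mk : measurable_fun setT (fun w : plane => (E w / (1 + rho w))%:E).
  apply/measurable_EFinP; apply: measurable_funM => //.
  exact: measurable_1Drho_inv.
have c1 : 0 <= 2 * K * C / c by rewrite divr_ge0 ?mulr_ge0// ltW.
have c2 : 0 <= (1 + K * M) / d + K by rewrite addr_ge0 ?divr_ge0 ?addr_ge0 ?mulr_ge0// ltW.
have k0 w : 0 <= E w / (1 + rho w) by rewrite divr_ge0 ?addr_ge0 ?rho_ge0.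
rewrite -(Ht (fun w => (rho_near d w)%:E)); last 2 first.
- by apply/measurable_EFinP; exact: measurable_rho_near.
- by move=> w; rewrite lee_fin rho_near_ge0.
rewrite mul1e -!ge0_integralZl//; last 2 first.
- by move=> w _; rewrite lee_fin.
- by move=> w _; rewrite lee_fin rho_near_ge0.
rewrite -ge0_integralD; last 5 first.
- exact: measurableT.
- by move=> w _; rewrite -EFinM lee_fin mulr_ge0// rho_near_ge0.
- exact: measurable_funeM.
- by move=> w _; rewrite -EFinM lee_fin mulr_ge0.
- exact: measurable_funeM.
apply: ge0_le_integral => //.
- by move=> w _; rewrite lee_fin divr_ge0 ?rho_ge0.
- apply/measurable_EFinP; apply: measurable_funM => //.
  apply: (measurableT_comp (f := fun w : plane => (rho w)^-1)) mt; exact: measurable_rho_inv.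
- by apply: emeasurable_funD; exact: measurable_funeM.
- move=> w _; rewrite -!EFinM -EFinD lee_fin.
  by apply: (@shifted_kernel_le E C c M d s w) => //; exact: EC.
Qed.

End kernel.

(** * Lattice sums as integrals *)

Section lattice.
Context {R : realType}.
Local Notation plane := (measurableTypeR R * measurableTypeR R)%type.
Implicit Types (k t : int * int) (u v w s : R * R).

Definition cell v : int * int := (Num.floor v.1, Num.floor v.2).

Lemma cellD v t : cell (v + Z2R t) = cell v + t.
Proof. by rewrite /cell /Z2R/= !floorDrz ?intr_int// !intrKfloor; case: t. Qed.

Lemma cell_preimage k :
  cell @^-1` [set k] = (`[k.1%:~R, (k.1 + 1)%:~R[%classic `*`
    `[k.2%:~R, (k.2 + 1)%:~R[%classic : set plane).
Proof.
apply/seteqP; split => -[x y]; rewrite /cell/= !in_itv/=.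
  by move=> <-; rewrite !floor_itv.
by move=> [/floor_def -> /floor_def ->]; case: k.
Qed.

Lemma measurable_cell_preimage k : measurable (cell @^-1` [set k] : set plane).
Proof. by rewrite cell_preimage; apply: measurableX; exact: measurable_itv. Qed.

Lemma area_cell k : leb2 R (cell @^-1` [set k]) = 1%E.
Proof.
rewrite cell_preimage.
have e (m : int) : leb R (`[m%:~R, (m + 1)%:~R[%classic : set (measurableTypeR R)) = 1%E.
  by rewrite lebesgue_measure_itv/= lte_fin ltr_int ltrDl -EFinB intrD addrAC subrr add0r.
rewrite (lebesgue2_rect (measurable_itv _) (measurable_itv _)).
by rewrite !e mule1.
Qed.

(** Preimages under [cell] are countable unions of unit squares. *)
Lemma measurable_cell_comp d (T : measurableType d) (F : int * int -> T) :
  measurable_fun setT (F \o cell : plane -> T).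
Proof.
move=> _ Y mY; rewrite setTI.
have -> : (F \o cell) @^-1` Y =
    \bigcup_k (if pselect (Y (F k)) then cell @^-1` [set k] : set plane else set0).
  apply/seteqP; split => v /=.
    by move=> Yv; exists (cell v) => //; case: pselect.
  by move=> [k _]; case: pselect => // Yk /= ->.
apply: countable_bigcupT_measurable => // k.
by case: pselect => ?; [exact: measurable_cell_preimage|exact: measurable0].
Qed.

(** The unit squares attached to the lattice points have area 1 and partition the
plane. *)
Lemma esum_cell (F : int * int -> \bar R) : (forall k, 0 <= F k)%E ->
  (\esum_(k in setT) F k = \int[leb2 R]_v F (cell v))%E.
Proof.
move=> F0.
(* The points of Z^2 are enumerated by [pickle_inv]; the natural numbers that
   encode no point receive the empty set and the value 0. *)
pose sq n : set plane := if pickle_inv n is Some k then cell @^-1` [set k] else set0.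
pose tm n : \bar R := if pickle_inv n is Some k then F k else 0%E.
have bigsq : \bigcup_n sq n = setT.
  rewrite -subTset => v _; exists (pickle (cell v)); first by [].
  by rewrite /sq pickleK_inv.
rewrite -bigsq ge0_integral_bigcup//; last 3 first.
- by rewrite /sq => n; case: pickle_inv => // k; exact: measurable_cell_preimage.
- by rewrite bigsq; exact: measurable_cell_comp.
- have sqE n v : sq n v -> n = pickle (cell v).
    rewrite /sq; have := @pickle_invK (int * int)%type n.
    by case: (pickle_inv n) => [k|//] /= <- ->.
  apply/trivIsetP => i j _ _ ij; rewrite -subset0 => v [/sqE iv /sqE jv].
  by move: ij; rewrite iv jv eqxx.
have -> : (\sum_(n <oo) \int[leb2 R]_(v in sq n) F (cell v) = \sum_(n <oo) tm n)%E.
  apply: eq_eseriesr => n _; rewrite /sq /tm; case: pickle_inv => [k|]; last by rewrite integral_set0.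
  rewrite (eq_integral (cst (F k))); last by move=> v; rewrite inE /= => ->.
  transitivity (F k * leb2 R (cell @^-1` [set k]))%E.
    exact: (integral_cst _ (measurable_cell_preimage k)).
  by rewrite area_cell mule1.
have tm0 n : (0 <= tm n)%E by rewrite /tm; case: pickle_inv.
rewrite nneseries_esumT//.
have -> : (\esum_(k in setT) F k = \esum_(n in range (@pickle (int * int)%type)) tm n)%E.
  rewrite (@reindex_esum R (int * int)%type nat setT
    (range (@pickle (int * int)%type)) (@pickle (int * int)%type)).
    by apply: eq_esum => k _; rewrite /tm pickleK_inv.
  split; [by []| |by []].
  by move=> i j _ _; exact: (pcan_inj pickleK_inv).
rewrite esum_mkcond; apply: eq_esum => n _.
case: ifPn => //; rewrite notin_setE => nr; rewrite /tm.
have := @pickle_invK (int * int)%type n; case: pickle_inv => //= k kn.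
by exfalso; apply: nr; exists k.
Qed.

Variables (q1 q2 : R) (B : 'M[R]_2).
Hypothesis B_unit : B \in unitmx.
Local Notation Q := (q1^-1 + q2^-1).
Local Notation dil := (@dilation R q1 q2).

Lemma mulMpD (A : 'M[R]_2) u v : mulMp A (u + v) = mulMp A u + mulMp A v.
Proof. by rewrite /mulMp/=; congr pair => /=; ring. Qed.

Lemma mulMpM (A A' : 'M[R]_2) u : mulMp A (mulMp A' u) = mulMp (A *m A') u.
Proof.
rewrite /mulMp !mxE !big_ord_recl !big_ord0/= !addr0.
have -> : lift ord0 ord0 = 1 :> 'I_2 by exact: val_inj.
by congr pair; ring.
Qed.

Lemma mulMp1 u : mulMp 1%:M u = u.
Proof. by rewrite /mulMp !mxE/= !mul1r !mul0r addr0 add0r; case: u. Qed.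

Lemma mulMpVK u : mulMp (invmx B) (mulMp B u) = u.
Proof. by rewrite mulMpM mulVmx// mulMp1. Qed.

Lemma mulMpKV u : mulMp B (mulMp (invmx B) u) = u.
Proof. by rewrite mulMpM mulmxV// mulMp1. Qed.

Definition lattice_point m w : int * int := cell (mulMp (invmx B) (dil m w)).

Local Notation lat := lattice_point.

(** Thanks to this identity both factors of the discrete convolution are sampled
by the same map, the second one at a translated point of the plane. *)
Lemma lat_shift m w t : 0 < m ->
  lat m (w + dil m^-1 (mulMp B (Z2R t))) = lat m w + t.
Proof. by move=> m0; rewrite /lat dilD dilVK// mulMpD mulMpVK cellD. Qed.

Lemma measurable_lat_comp m d (T : measurableType d) (F : int * int -> T) : 0 < m ->
  measurable_fun setT (F \o lat m : plane -> T).
Proof.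
move=> m0.
have B'u : invmx B \in unitmx by rewrite unitmx_inv.
have [mB _] := scales_area_mulMp B'u; have [md _] := @scales_area_dil R q1 q2 _ m0.
apply: (measurableT_comp (f := F \o cell : plane -> T)); first exact: measurable_cell_comp.
exact: measurableT_comp mB md.
Qed.

Lemma esum_lat (F : int * int -> \bar R) m : 0 < m -> (forall k, 0 <= F k)%E ->
  (\esum_(k in setT) F k =
   (m `^ Q * `|\det B|^-1)%:E * \int[leb2 R]_w F (lat m w))%E.
Proof.
move=> m0 F0; rewrite esum_cell//.
have B'u : invmx B \in unitmx by rewrite unitmx_inv.
have [mB HB] := scales_area_mulMp B'u; have [md Hd] := @scales_area_dil R q1 q2 _ m0.
have mF : measurable_fun setT (F \o cell : plane -> \bar R) by exact: measurable_cell_comp.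
rewrite -(HB (F \o cell))//; last by move=> v; exact: F0.
rewrite -(Hd (F \o cell \o mulMp (invmx B))); last 2 first.
- exact: measurableT_comp mF mB.
- by move=> v; exact: F0.
by rewrite muleA -EFinM mulrC det_inv normfV.
Qed.

End lattice.

(** * Angular functions *)

Section profile.
Context {R : realType}.
Variables q1 q2 : R.
Hypotheses (q1_gt0 : 0 < q1) (q2_gt0 : 0 < q2).
Local Notation rho := (@rho R q1 q2).
Local Notation dil := (@dilation R q1 q2).
Local Notation plane := (measurableTypeR R * measurableTypeR R)%type.

(** The properties of an angular function on which the limit theorem rests; no
continuity is asked at the origin, where the invariance under dilations would
force the function to be constant. *)
Record profile (L : R * R -> R) : Prop := Profile {
  profile_bounded : exists2 M, 0 <= M & forall u, `|L u| <= M;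
  profile_continuous : forall u, u != 0 -> {for u, continuous L};
  profile_dil : forall m u, 0 < m -> L (dil m u) = L u;
  profile_measurable : measurable_fun setT (L : plane -> R) }.

Definition angle (u : R * R) : R := u.1 / rho u `^ q1^-1.

Lemma angle_norm_le1 u : `|angle u| <= 1.
Proof.
rewrite /angle normrM normfV (ger0_norm (powR_ge0 _ _)).
have h : `|u.1| <= rho u `^ q1^-1.
  rewrite -[leLHS](powR_invK q1_gt0)//.
  have qV0 : 0 <= q1^-1 by rewrite invr_ge0 ltW.
  by rewrite (ge0_ler_powR qV0) ?nnegrE ?powR_ge0 ?rho_ge0// lerDl powR_ge0.
have := powR_ge0 (rho u) q1^-1; rewrite le_eqVlt => /orP[/eqP <-|r0].
  by rewrite invr0 mulr0.
by rewrite ler_pdivrMr// mul1r.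
Qed.

(** The retraction of the line onto [-1, 1]. Composing with it turns a function that
is continuous on this interval into one that is continuous, hence measurable, on
the whole line. *)
Definition clamp (x : R) : R := Num.max (-1) (Num.min x 1).

Lemma clamp_itv x : -1 <= clamp x <= 1.
Proof. rewrite /clamp le_max lexx ge_max ge_min lexx orbT andbT/=; lra. Qed.

Lemma clamp_id x : `|x| <= 1 -> clamp x = x.
Proof. by rewrite ler_norml => /andP[h1 h2]; rewrite /clamp min_l// max_r. Qed.

Lemma clamp_continuous : continuous clamp.
Proof.
move=> x; suff : {for x, continuous
  ((cst (-1) : R -> R^o) \max ((id : R -> R^o) \min (cst 1 : R -> R^o)))} by [].
apply: continuous_max; first exact: cst_continuous.
by apply: continuous_min; [exact: cvg_id|exact: cst_continuous].
Qed.

Lemma continuous_clamp_comp (f : R -> R) :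
  {within `[-1, 1], continuous f} -> continuous (f \o clamp).
Proof.
move=> /subspace_continuousP cf x U /= Ux.
have cx : `[-1, 1]%classic (clamp x) by rewrite /= in_itv/= clamp_itv.
have H : \forall y \near clamp x, `[-1, 1]%classic y -> U (f y) := cf _ cx U Ux.
have H' : \forall y \near x, `[-1, 1]%classic (clamp y) -> U (f (clamp y)) := clamp_continuous H.
by apply: filterS H' => y /=; apply; rewrite in_itv/= clamp_itv.
Qed.

Lemma angular_if Lp Lm u : angular q1 q2 Lp Lm u =
  if u.2 < 0 then Lm (clamp (angle u)) else Lp (clamp (angle u)).
Proof.
rewrite clamp_id ?angle_norm_le1// /angular -/(angle u).
by rewrite [0 <= _]leNgt; case: ifP => _; rewrite !(mulr1, mulr0, addr0, add0r).
Qed.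

Lemma bounded_itv (f : R -> R) : {within `[-1, 1], continuous f} ->
  exists2 M, 0 <= M & forall x, `|f (clamp x)| <= M.
Proof.
move=> cf; have N11 : -1 <= 1 :> R by [].
have [c _ fc] := EVT_max N11 cf; have [d _ fd] := EVT_min N11 cf.
exists (`|f c| + `|f d|); first by rewrite addr_ge0.
move=> x; have xI : clamp x \in `[-1, 1] by rewrite in_itv/= clamp_itv.
rewrite ler_norml; apply/andP; split.
  rewrite (le_trans _ (fd _ xI))// opprD -[leRHS]add0r lerD ?oppr_le0//.
  by rewrite lerNl ler_normr lexx orbT.
rewrite (le_trans (fc _ xI))// -[leLHS]addr0 lerD//; exact: ler_norm.
Qed.

Lemma angle_dil m u : 0 < m -> angle (dil m u) = angle u.
Proof.
move=> m0; rewrite /angle (rho_dil q1_gt0 q2_gt0 _ (ltW m0)) powRM ?rho_ge0 ?(ltW m0)//=.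
by rewrite invfM mulrACA divff ?mul1r// gt_eqF// powR_gt0.
Qed.

Lemma angle_continuous u : u != 0 -> {for u, continuous angle}.
Proof.
move=> u0; have r0 := rho_gt0 q1_gt0 q2_gt0 u0.
apply: cvgM; first exact: cvg_fst.
apply: cvgV; first by rewrite gt_eqF// powR_gt0.
have H : {for u, continuous ((fun x : R => `|x| `^ q1^-1) \o rho)}.
  apply: continuous_comp; first exact: rho_continuous.
  by apply: continuous_powR_norm; rewrite invr_gt0.
have E : (fun x : R => `|x| `^ q1^-1) \o rho = (fun v => rho v `^ q1^-1).
  by apply/funext => v /=; rewrite ger0_norm// rho_ge0.
by rewrite E in H; exact: H.
Qed.

Lemma angle_axis u : u != 0 -> u.2 = 0 -> angle u = 1 \/ angle u = -1.
Proof.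
move=> u0 u2; have u1 : u.1 != 0.
  by apply: contraNneq u0 => u1; case: u u1 u2 => a b /= -> ->.
have -> : angle u = u.1 / `|u.1|.
  by rewrite /angle /rho u2 normr0 powR0 ?(gt_eqF q2_gt0)// addr0 powR_invK.
have [p|n] := ltP 0 u.1; first by left; rewrite gtr0_norm// divff.
by right; rewrite ler0_norm// invrN mulrN divff.
Qed.

Lemma measurable_angle : measurable_fun setT (angle : plane -> R).
Proof.
apply: measurable_funM; first exact: measurable_fst.
apply: measurable_invr_ge0; first by move=> ?; exact: powR_ge0.
apply: (@measurableT_comp _ _ _ _ _ _ (fun x : R => x `^ q1^-1)); first exact: measurable_powR.
exact: measurable_rho.
Qed.

Lemma near_dist_lt (f : R * R -> R) (u : R * R) (e : R) :
  {for u, continuous f} -> 0 < e -> \forall v \near u, `|f u - f v| < e.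
Proof. by move=> cf e0; have /cvgrPdist_lt := cf; exact. Qed.

Lemma near_eq_continuous (f g : R * R -> R) (u : R * R) :
  {for u, continuous f} -> (\forall v \near u, f v = g v) -> {for u, continuous g}.
Proof.
move=> cf fg; rewrite /prop_for /continuous_at -(nbhs_singleton fg).
by apply: cvg_trans cf; apply: near_eq_cvg; exact: fg.
Qed.

(** The two branches are continuous away from the origin, and they match where they
meet: on the axis u.2 = 0 the angle is 1 or -1. *)
Lemma angular_profile Lp Lm : angular_pair Lp Lm -> profile (angular q1 q2 Lp Lm).
Proof.
move=> [cp cm e1 eN1].
have Pc u : u != 0 -> {for u, continuous (fun u => Lp (clamp (angle u)))}.
  move=> u0; apply: (@continuous_comp _ _ _ angle (Lp \o clamp)); first exact: angle_continuous.
  exact: continuous_clamp_comp.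
have Mc u : u != 0 -> {for u, continuous (fun u => Lm (clamp (angle u)))}.
  move=> u0; apply: (@continuous_comp _ _ _ angle (Lm \o clamp)); first exact: angle_continuous.
  exact: continuous_clamp_comp.
split.
- have [M1 M10 H1] := bounded_itv cp; have [M2 M20 H2] := bounded_itv cm.
  exists (M1 + M2); first by rewrite addr_ge0.
  move=> u; rewrite angular_if; case: ifP => _.
    by rewrite (le_trans (H2 _))// lerDr.
  by rewrite (le_trans (H1 _))// lerDl.
- move=> u u0.
  have s2 : {for u, continuous (snd : R * R -> R)} by exact: cvg_snd.
  have [u2|u2|u2] := ltgtP u.2 0.
  + have : \forall v \near u, v.2 < 0 by exact: (cvgr_lt _ s2).
    move=> H; apply: (near_eq_continuous (Mc _ u0)).
    by apply: filterS H => v v2; rewrite angular_if v2.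
  + have : \forall v \near u, 0 < v.2 by exact: (cvgr_gt _ s2).
    move=> H; apply: (near_eq_continuous (Pc _ u0)).
    by apply: filterS H => v v2; rewrite angular_if ltNge ltW.
  + have eu : Lm (clamp (angle u)) = Lp (clamp (angle u)).
      by rewrite clamp_id ?angle_norm_le1//; have [->|->] := angle_axis u0 u2.
    have eA : angular q1 q2 Lp Lm u = Lp (clamp (angle u)) by rewrite angular_if u2 ltxx.
    apply/cvgrPdist_lt => e e0.
    apply: filterS2 (near_dist_lt (Pc _ u0) e0) (near_dist_lt (Mc _ u0) e0) => v h1 h2.
    by rewrite eA angular_if; case: ifP => _; [rewrite -eu|].
- move=> m u m0; rewrite !angular_if angle_dil//=.
  by rewrite pmulr_rlt0// powR_gt0.
- rewrite (_ : angular q1 q2 Lp Lm = (fun u : plane =>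
    if u.2 < 0 then Lm (clamp (angle u)) else Lp (clamp (angle u)))); last first.
    by apply/funext => u; exact: angular_if.
  apply: measurable_fun_ifT.
  + by apply: measurable_fun_ltr => //; exact: measurable_snd.
  + apply: (measurableT_comp (f := Lm \o clamp : measurableTypeR R -> measurableTypeR R)) measurable_angle.
    apply: continuous_measurable_fun; exact: continuous_clamp_comp.
  + apply: (measurableT_comp (f := Lp \o clamp : measurableTypeR R -> measurableTypeR R)) measurable_angle.
    apply: continuous_measurable_fun; exact: continuous_clamp_comp.
Qed.

End profile.

(** * Rescaled lattice functions *)

Section growth.
Context {R : realType}.
Implicit Types (k t : int * int) (u v w s : R * R).

(** Only finitely many lattice points satisfy norm1 t <= N. *)
Lemma norm1_bounded (h : int * int -> R) (N : int) : (forall t, 0 <= h t) ->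
  exists2 C, 0 <= C & forall t, norm1 t <= N -> h t <= C.
Proof.
move=> h0; pose n := `|N|%N.
(* The sum of h over the square of side 2n + 1 centred at the origin. *)
exists (\sum_(i < n.*2.+1) \sum_(j < n.*2.+1) h ((i : int) - n%:Z, (j : int) - n%:Z)).
  by apply: sumr_ge0 => i _; apply: sumr_ge0.
move=> t tN.
have tn : (`|t.1| <= n)%N /\ (`|t.2| <= n)%N.
  have : (`|t.1| + `|t.2| <= N)%R by [].
  rewrite /n; lia.
have key (x : int) : (`|x| <= n)%N -> exists i : 'I_n.*2.+1, x = (i : int) - n%:Z.
  move=> xn.
  have lt : (absz (x + n%:Z)%R < n.*2.+1)%N by lia.
  by exists (Ordinal lt) => /=; lia.
have [i e1] := key _ tn.1; have [j e2] := key _ tn.2.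
rewrite (bigD1 i)//= (bigD1 j)//= -e1 -e2 -surjective_pairing -addrA lerDl.
by rewrite addr_ge0// sumr_ge0// => ? _; rewrite sumr_ge0.
Qed.

Variables (q1 q2 : R) (B : 'M[R]_2).
Hypotheses (q1_gt0 : 0 < q1) (q2_gt0 : 0 < q2) (B_unit : B \in unitmx).
Local Notation rho := (@rho R q1 q2).
Local Notation dil := (@dilation R q1 q2).
Local Notation K := (rhoD_cst q1 q2).
Local Notation rhoB t := (rho (mulMp B (Z2R t))).

Lemma coord_le_rho (e u : R) (q : R) :
  0 < q -> 0 <= e -> `|u| `^ q <= e -> `|u| <= e `^ q^-1.
Proof.
move=> q0 e0 h; rewrite -[leLHS](@powR_invK _ q)//.
have qV0 : 0 <= q^-1 by rewrite invr_ge0 ltW.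
by rewrite (ge0_ler_powR qV0) ?nnegrE ?powR_ge0.
Qed.

(** The coordinates of t = B^-1 (B t) are controlled by those of B t, which are
controlled by rho (B t). *)
Lemma rhoB_le_norm1 (C : R) : exists N : int, forall t, rhoB t <= C -> norm1 t <= N.
Proof.
pose D := Num.max C 0.
have D0 : 0 <= D by rewrite le_max lexx orbT.
pose S := D `^ q1^-1 + D `^ q2^-1.
have S0 : 0 <= S by rewrite addr_ge0 ?powR_ge0.
pose A := invmx B.
pose T := (`|A 0 0| + `|A 0 1| + `|A 1 0| + `|A 1 1|) * S.
exists (Num.floor T + 1) => t tC.
have {}tC : rhoB t <= D by rewrite le_max tC.
set v := mulMp B (Z2R t) in tC.
have v1 : `|v.1| <= S.
  apply: (@le_trans _ _ (D `^ q1^-1)); last by rewrite lerDl powR_ge0.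
  by apply: coord_le_rho => //; apply: le_trans tC; rewrite lerDl powR_ge0.
have v2 : `|v.2| <= S.
  apply: (@le_trans _ _ (D `^ q2^-1)); last by rewrite lerDr powR_ge0.
  by apply: coord_le_rho => //; apply: le_trans tC; rewrite lerDr powR_ge0.
have tE : Z2R t = mulMp A v by rewrite /v mulMpVK.
have nT : (norm1 t)%:~R <= T.
  have e1 : (t.1%:~R : R) = A 0 0 * v.1 + A 0 1 * v.2 by have := congr1 fst tE.
  have e2 : (t.2%:~R : R) = A 1 0 * v.1 + A 1 1 * v.2 by have := congr1 snd tE.
  rewrite /norm1 intrD !intr_norm e1 e2 /T.
  have H (x y : R) : `|x * v.1 + y * v.2| <= (`|x| + `|y|) * S.
    rewrite (le_trans (ler_normD _ _))// !normrM mulrDl lerD// ler_wpM2l//.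
  by rewrite (le_trans (lerD (H _ _) (H _ _)))// -mulrDl !addrA.
by rewrite -(ler_int R) (le_trans nT)// ltW// floorD1_gt.
Qed.

Lemma rhoB_gt_near (C : R) : \forall t \near Z2infty, C < rhoB t.
Proof.
have [N NC] := rhoB_le_norm1 C.
exists N => // t /= Nt; rewrite ltNge; apply/negP => /NC.
by rewrite leNgt Nt.
Qed.

Lemma near_Z2infty_rhoB (P : set (int * int)) : (\forall t \near Z2infty, P t) ->
  exists C, forall t, C < rhoB t -> P t.
Proof.
move=> [N _ NP].
have [C C0 HC] := @norm1_bounded (fun t => rhoB t) N (fun t => rho_ge0 q1 q2 _).
exists C => t Ct; apply: NP => /=; rewrite ltNge; apply/negP => /HC.
by rewrite leNgt Ct.
Qed.

(** The sets rho (v - u) < d form a basis of neighbourhoods of u. *)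
Lemma near_rho (U : set (R * R)) u : nbhs u U ->
  exists2 d, 0 < d & forall v, rho (v - u) < d -> U v.
Proof.
move=> /nbhs_ballP[e /= e0 eU].
exists (Num.min (e `^ q1) (e `^ q2)); first by rewrite lt_min !powR_gt0.
move=> v; rewrite lt_min => /andP[h1 h2]; apply: eU.
have c (q x : R) : 0 < q -> `|x| `^ q < e `^ q -> `|x| < e.
  move=> q0; apply: contraTT; rewrite -!leNgt => ex.
  by rewrite (ge0_ler_powR (ltW q0)) ?nnegrE// ltW.
split; rewrite /ball/= distrC.
  by apply: (c q1) => //; apply: le_lt_trans h1; rewrite lerDl powR_ge0.
by apply: (c q2) => //; apply: le_lt_trans h2; rewrite lerDr powR_ge0.
Qed.

Local Notation lat := (lattice_point q1 q2 B).

(** The error is the image under B of a fractional part, whatever the scale is. *)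
Lemma lat_error : exists2 M, 0 <= M & forall m w,
  rho (mulMp B (Z2R (lat m w)) - dil m w) <= M.
Proof.
pose S := `|B 0 0| + `|B 0 1| + `|B 1 0| + `|B 1 1|.
have S0 : 0 <= S by rewrite !addr_ge0.
exists (S `^ q1 + S `^ q2); first by rewrite addr_ge0 ?powR_ge0.
move=> m w; set v := mulMp (invmx B) (dil m w).
have -> : mulMp B (Z2R (lat m w)) - dil m w = mulMp B (Z2R (cell v) - v).
  rewrite -[dil m w](mulMpKV B_unit) -/v /lat -/v.
  by rewrite /mulMp/=; congr pair => /=; ring.
set f := Z2R (cell v) - v.
have fl (x : R) : `|(Num.floor x)%:~R - x| <= 1.
  rewrite ler_norml; have /andP[h1 h2] := floor_itv x; move: h2; rewrite intrD.
  by move=> h2; apply/andP; split; lra.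
have f1 : `|f.1| <= 1 by exact: fl.
have f2 : `|f.2| <= 1 by exact: fl.
have H (x y : R) : `|x * f.1 + y * f.2| <= `|x| + `|y|.
  rewrite (le_trans (ler_normD _ _))// !normrM lerD// ler_piMr//.
rewrite /Defs.rho/= lerD//.
  rewrite (ge0_ler_powR (ltW q1_gt0)) ?nnegrE//.
  by rewrite (le_trans (H _ _))// /S -[leRHS]addrA lerDl addr_ge0.
rewrite (ge0_ler_powR (ltW q2_gt0)) ?nnegrE//.
by rewrite (le_trans (H _ _))// /S -[leRHS]addrA lerDr addr_ge0.
Qed.

Lemma asymp_bound L g : profile q1 q2 L -> asymp B q1 q2 L g ->
  exists2 C, 0 <= C & forall t, `|g t| <= C / (1 + rhoB t).
Proof.
move=> pL [r r0 gE]; have [M M0 LM] := profile_bounded pL.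
have r1 : \forall t \near Z2infty, `|r t| < 1.
  by have /cvgrPdist_lt/(_ _ ltr01) := r0; apply: filterS => t; rewrite sub0r normrN.
have : \forall t \near Z2infty, `|g t| <= (2 * (M + 1)) / (1 + rhoB t).
  near=> t.
  have gt : g t = (rhoB t)^-1 * (L (mulMp B (Z2R t)) + r t) by near: t.
  have rt : `|r t| < 1 by near: t.
  have Bt : 1 < rhoB t by near: t; exact: rhoB_gt_near.
  have Bt0 : 0 < rhoB t by rewrite (lt_trans ltr01).
  rewrite gt normrM normfV (gtr0_norm Bt0) mulrC.
  have h1 : `|L (mulMp B (Z2R t)) + r t| <= M + 1.
    by rewrite (le_trans (ler_normD _ _))// lerD// ltW.
  have h2 : (rhoB t)^-1 <= 2 / (1 + rhoB t).
    have D0 : 0 < 1 + rhoB t by rewrite ltr_pwDl// ltW.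
    rewrite (ler_pdivlMr _ _ D0) [leLHS]mulrC ler_pdivrMr//.
    by rewrite mulr_natl mulr2n lerD2r ltW.
  rewrite [leRHS](_ : _ = (M + 1) * (2 / (1 + rhoB t))); last by ring.
  by rewrite ler_pM// invr_ge0 ltW.
move=> [N _ HN].
have [C C0 HC] := @norm1_bounded (fun t => `|g t| * (1 + rhoB t)) N
  (fun t => mulr_ge0 (normr_ge0 _) (addr_ge0 ler01 (rho_ge0 q1 q2 _))).
exists (C + 2 * (M + 1)); first by rewrite !addr_ge0// mulr_ge0// addr_ge0.
move=> t; have D0 : 0 < 1 + rhoB t by rewrite ltr_pwDl// rho_ge0.
have [tN|Nt] := leP (norm1 t) N.
  rewrite ler_pdivlMr// (le_trans (HC _ tN))// lerDl mulr_ge0// addr_ge0//.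
rewrite (le_trans (HN _ Nt))// ler_wpM2r ?invr_ge0 ?(ltW D0)// lerDr//.
Unshelve. all: by end_near. Qed.

(** B (lat m w) is at bounded distance from dil m w, so that 1 + rho takes
comparable values at these two points, and rho (dil m w) = m rho w. *)
Lemma lat_bound (g : int * int -> R) C : 0 <= C -> (forall t, `|g t| <= C / (1 + rhoB t)) ->
  exists2 C', 0 <= C' & forall m w, 0 < m -> `|g (lat m w)| <= C' / (1 + m * rho w).
Proof.
move=> C0 gC; have [M M0 HM] := lat_error; have K0 := rhoD_cst_gt0 q1 q2.
exists (C * (1 + K * M + K)); first by rewrite !mulr_ge0 ?addr_ge0 ?mulr_ge0// ltW.
move=> m w m0; set k := lat m w.
have D0 : 0 < 1 + rhoB k by rewrite ltr_pwDl// rho_ge0.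
have D1 : 0 < 1 + m * rho w by rewrite ltr_pwDl// mulr_ge0 ?rho_ge0 ?ltW.
rewrite (le_trans (gC _))// ler_pdivrMr// mulrAC ler_pdivlMr// -mulrA ler_wpM2l//.
rewrite -(rho_dil q1_gt0 q2_gt0 _ (ltW m0)).
have := rhoD q1_gt0 q2_gt0 (mulMp B (Z2R k)) (- (mulMp B (Z2R k) - dil m w)).
rewrite rhoN opprB addrCA subrr addr0; have := HM m w; rewrite -/k.
set b := rho (_ - _) => bM h.
have h2 : rho (dil m w) <= K * (rhoB k + M).
  by rewrite (le_trans h)// (ler_wpM2l (ltW K0))// lerD2l.
have := mulr_ge0 (mulr_ge0 (ltW K0) M0) (rho_ge0 q1 q2 (mulMp B (Z2R k))).
have := rho_ge0 q1 q2 (mulMp B (Z2R k)); move: h2 K0; move: (rhoB k) (rho (dil m w)) => x y; nra.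
Qed.

Lemma a_infty_continuous L u : profile q1 q2 L -> u != 0 ->
  {for u, continuous (a_infty q1 q2 L)}.
Proof.
move=> pL u0; apply: cvgM; last exact: (profile_continuous pL u0).
apply: cvgV; first by rewrite gt_eqF// rho_gt0.
exact: rho_continuous.
Qed.

(** B (lat m w) = dil m w' for some w' that tends to w, since the rounding error is
divided by a power of m. By homogeneity m g (lat m w) is then a_infty (w') plus
an error term, and a_infty is continuous at w. *)
Lemma lat_rescaled_cvg L (g : int * int -> R) w :
  profile q1 q2 L -> asymp B q1 q2 L g -> w != 0 ->
  m * g (lat m w) @[m --> +oo] --> a_infty q1 q2 L w.
Proof.
move=> pL [r r0 gE] w0; have rw := rho_gt0 q1_gt0 q2_gt0 w0.
have [M M0 HM] := lat_error.
apply/cvgrPdist_lt => e e0; have e2 : 0 < e / 2 by rewrite divr_gt0.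
have nearw : \forall v \near w, `|a_infty q1 q2 L w - a_infty q1 q2 L v| < e / 2 /\ rho w / 2 < rho v.
  apply: filterI; first exact: near_dist_lt (a_infty_continuous pL w0) e2.
  have rc : rho v @[v --> w] --> rho w by exact: rho_continuous.
  by apply: (cvgr_gt _ rc); rewrite ltr_pdivrMr// ltr_pMr// ltr1n.
have [d d0 dP] := near_rho nearw.
have e4 : 0 < e * rho w / 4 by rewrite divr_gt0// mulr_gt0.
have nk : \forall t \near Z2infty, `|r t| < e * rho w / 4 /\
   g t = (rhoB t)^-1 * (L (mulMp B (Z2R t)) + r t).
  apply: filterI => //.
  by have /cvgrPdist_lt/(_ _ e4) := r0; apply: filterS => t; rewrite sub0r normrN.
have [C HC] := near_Z2infty_rhoB nk.
near=> m.
have m0 : 0 < m by near: m; apply: nbhs_pinfty_gt; exact: num_real.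
have mM : M / d < m by near: m; apply: nbhs_pinfty_gt; exact: num_real.
have mC : 2 * C / rho w < m by near: m; apply: nbhs_pinfty_gt; exact: num_real.
set k := lat m w; pose b := mulMp B (Z2R k) - dil m w.
pose w' := w + dil m^-1 b.
have BE : mulMp B (Z2R k) = dil m w'.
  by rewrite /w' dilD dilVK// /b addrCA subrr addr0.
have [aw rw'] : `|a_infty q1 q2 L w - a_infty q1 q2 L w'| < e / 2 /\ rho w / 2 < rho w'.
  apply: dP; rewrite /w' addrAC subrr add0r (rho_dil q1_gt0 q2_gt0) ?invr_ge0 ?(ltW m0)//.
  rewrite mulrC ltr_pdivrMr//; apply: (le_lt_trans (HM _ _)).
  by rewrite mulrC -ltr_pdivrMr.
have rw'0 : 0 < rho w' by rewrite (lt_trans _ rw')// divr_gt0.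
have rBk : rhoB k = m * rho w' by rewrite BE (rho_dil q1_gt0 q2_gt0)// ltW.
have [rk gk] : `|r k| < e * rho w / 4 /\ g k = (rhoB k)^-1 * (L (mulMp B (Z2R k)) + r k).
  apply: HC; rewrite rBk; apply: (@lt_trans _ _ (m * (rho w / 2))); last by rewrite ltr_pM2l.
  move: mC; rewrite ltr_pdivrMr// => mC; rewrite mulrA ltr_pdivlMr// mulrC//.
have mg : m * g k = a_infty q1 q2 L w' + (rho w')^-1 * r k.
  rewrite gk rBk BE (profile_dil pL)// /a_infty invfM !mulrA mulfV ?gt_eqF// mul1r.
  by rewrite mulrDr.
rewrite mg opprD addrA (le_lt_trans (ler_normB _ _))//.
have -> : e = e / 2 + e / 2 by rewrite -splitr.
rewrite ltr_leD// normrM normfV (gtr0_norm rw'0) mulrC ler_pdivrMr//.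
have : e / 2 * (rho w / 2) <= e / 2 * rho w' by rewrite ler_pM2l// ltW.
apply: le_trans; rewrite (le_trans (ltW rk))//.
by rewrite [leRHS](_ : _ = e * rho w / 4)//; field.
Unshelve. all: by end_near. Qed.

End growth.

(** * Distance of a rescaled function to its limit *)

Section deviation.
Context {R : realType}.
Variables (q1 q2 : R) (B : 'M[R]_2).
Hypotheses (q1_gt0 : 0 < q1) (q2_gt0 : 0 < q2) (B_unit : B \in unitmx).
Local Notation Q := (q1^-1 + q2^-1).
Hypotheses (Q_gt1 : 1 < Q) (Q_lt2 : Q < 2).
Local Notation rho := (@rho R q1 q2).
Local Notation dil := (@dilation R q1 q2).
Local Notation K := (rhoD_cst q1 q2).
Local Notation lat := (lattice_point q1 q2 B).
Local Notation a_infty := (a_infty q1 q2).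
Local Notation plane := (measurableTypeR R * measurableTypeR R)%type.

Lemma ae_neq (p : plane) : {ae leb2 R, forall w, w != p}.
Proof.
exists ([set p.1 : measurableTypeR R] `*` [set p.2 : measurableTypeR R]); split.
- by apply: measurableX; exact: measurable_set1.
- rewrite (lebesgue2_rect (measurable_set1 _) (measurable_set1 _)).
  by rewrite lebesgue_measure_set1 mul0e.
- by move=> w /= /negP; rewrite negbK => /eqP wp; rewrite wp.
Qed.

Lemma a_infty_bound L : profile q1 q2 L ->
  exists2 M, 0 <= M & forall w, `|a_infty L w| <= M / rho w.
Proof.
move=> pL; have [M M0 LM] := profile_bounded pL; exists M => // w.
by rewrite normrM ger0_norm ?invr_ge0 ?rho_ge0// mulrC ler_wpM2r// invr_ge0 rho_ge0.
Qed.

Lemma measurable_a_infty L : profile q1 q2 L ->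
  measurable_fun setT (a_infty L : plane -> R).
Proof.
move=> pL; apply: measurable_funM; first exact: measurable_rho_inv.
exact: (profile_measurable pL).
Qed.

Lemma rescaled_bound L g : profile q1 q2 L -> asymp B q1 q2 L g ->
  exists2 C, 0 <= C & forall m w, 0 < m -> w != 0 -> `|m * g (lat m w)| <= C / rho w.
Proof.
move=> pL gL; have [C0 C00 H0] := asymp_bound q1_gt0 q2_gt0 B_unit pL gL.
have [C C_ge0 H] := lat_bound q1_gt0 q2_gt0 B_unit C00 H0.
exists C => // m w m0 w0; have rw := rho_gt0 q1_gt0 q2_gt0 w0.
rewrite normrM (gtr0_norm m0); have := H m w m0.
have D0 : 0 < 1 + m * rho w by rewrite addr_gt0// mulr_gt0.
rewrite ler_pdivlMr// => h; rewrite ler_pdivlMr//; apply: le_trans h.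
by rewrite [leRHS]mulrDr mulr1 mulrA [_ * m]mulrC lerDr.
Qed.

Definition deviation L (g : int * int -> R) (m : R) w := `|m * g (lat m w) - a_infty L w|.

Local Notation dev := deviation.

Lemma dev_bound L g : profile q1 q2 L -> asymp B q1 q2 L g ->
  exists2 C, 0 <= C & forall m w, 0 < m -> w != 0 -> dev L g m w <= C / rho w.
Proof.
move=> pL gL; have [C C0 HC] := rescaled_bound pL gL; have [M M0 HM] := a_infty_bound pL.
exists (C + M); first by rewrite addr_ge0.
move=> m w m0 w0; rewrite mulrDl (le_trans (ler_normB _ _))// lerD//; exact: HC.
Qed.

Lemma measurable_dev L g m : profile q1 q2 L -> 0 < m ->
  measurable_fun setT (dev L g m : plane -> R).
Proof.
move=> pL m0; apply: measurableT_comp; first exact: normr_measurable.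
apply: measurable_funB; last exact: measurable_a_infty.
apply: measurable_funM => //.
exact: (measurable_lat_comp q1 q2 B_unit (g : _ -> measurableTypeR R) m0).
Qed.

(** Dominated convergence, with a multiple of [rho_weight] as majorant. *)
Lemma dev_weight_small L g e : profile q1 q2 L -> asymp B q1 q2 L g -> 0 < e ->
  exists2 A, 0 < A & forall m, A <= m ->
    (\int[leb2 R]_w (dev L g m w / (1 + rho w))%:E <= e%:E)%E.
Proof.
move=> pL gL e0; apply: contrapT => H.
have {}H n : exists m, n.+1%:R <= m /\
    (e%:E < \int[leb2 R]_w (dev L g m w / (1 + rho w))%:E)%E.
  apply: contrapT => nH; apply: H; exists n.+1%:R => // m nm.
  rewrite leNgt; apply/negP => h; apply: nH; by exists m.
(* Scales u n tending to infinity along which the integrals exceed e. *)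
have [u Hu] := choice H.
have u0 n : 0 < u n by rewrite (lt_le_trans _ (Hu n).1).
have uoo : u n @[n --> \oo] --> +oo.
  apply/cvgryPge => M; near=> n; apply: le_trans (Hu n).1.
  rewrite (@le_trans _ _ n%:R)// ?ler_nat//.
  by near: n; exact: nbhs_infty_ger.
have [C C0 HC] := dev_bound pL gL.
pose f n (w : plane) := (dev L g (u n) w / (1 + rho w))%:E.
have mf n : measurable_fun setT (f n).
  apply/measurable_EFinP; apply: measurable_funM; first exact: measurable_dev.
  exact: measurable_1Drho_inv.
have weight_fin := integral_rho_weight_lty q1_gt0 q2_gt0 Q_gt1 Q_lt2.
have [||||_ _] := @dominated_convergence _ _ _ (leb2 R) setT measurableT f (cst 0%E)
   (fun w => (C * rho_weight q1 q2 w)%:E) mf.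
- exact: measurable_cst.
- apply: filterS (ae_neq 0) => w w0 _; rewrite /f.
  have rw : 1 + rho w != 0 by rewrite gt_eqF// ltr_pwDl// rho_ge0.
  apply/cvg_EFin; first by apply: nearW.
  rewrite -[X in _ --> X](mul0r (1 + rho w)^-1); apply: cvgM; last exact: cvg_cst.
  have := lat_rescaled_cvg q1_gt0 q2_gt0 B_unit pL gL w0.
  move=> /cvg_pinftyP/(_ _ uoo) h.
  have -> : 0 = `|a_infty L w - a_infty L w| :> R by rewrite subrr normr0.
  by apply: cvg_norm; apply: cvgB; [exact: h|exact: cvg_cst].
- apply/integrableP; split.
    by apply/measurable_EFinP; apply: measurable_funM => //; exact: (@measurable_rho_weight R q1 q2).
  under eq_integral do rewrite gee0_abs ?lee_fin ?mulr_ge0 ?rho_weight_ge0// EFinM.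
  rewrite ge0_integralZl//; last 2 first.
  + by apply/measurable_EFinP; exact: (@measurable_rho_weight R q1 q2).
  + by move=> w _; rewrite lee_fin rho_weight_ge0.
  by rewrite lte_mul_pinfty ?lee_fin.
- apply: filterS (ae_neq 0) => w w0 n _; rewrite /f lee_fin.
  have rw : 0 < 1 + rho w by rewrite ltr_pwDl// rho_ge0.
  have d0 : 0 <= dev L g (u n) w / (1 + rho w) by rewrite divr_ge0 ?normr_ge0 ?(ltW rw).
  rewrite (ger0_norm d0) /rho_weight invfM mulrA ler_wpM2r ?invr_ge0 ?(ltW rw)//.
  exact: HC.
rewrite integral0 => /= h.
have le_e : (e%:E <= limn (fun n => \int[leb2 R]_w f n w))%E.
  apply: lime_ge; first by apply/cvg_ex; exists 0%E; exact: h.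
  by apply: nearW => n; rewrite ltW// (Hu n).2.
have l0 : (limn (fun n => \int[leb2 R]_w f n w) = 0)%E by apply/cvg_lim => //; exact: h.
by move: le_e; rewrite l0 lee_fin leNgt e0.
Unshelve. all: by end_near. Qed.

(** The first term in [integral_shifted_kernel_le] is made small by the choice of
d, which depends neither on m nor on s; then the second one is small for m large,
uniformly in s because its weight does not involve s. *)
Lemma dev_shift_small L g c M e : profile q1 q2 L -> asymp B q1 q2 L g ->
  0 < c -> 0 < e ->
  exists2 A, 0 < A & forall m (s : R * R), A <= m -> c <= rho s -> rho s <= M ->
    (\int[leb2 R]_w (dev L g m w / rho (w + s))%:E <= e%:E)%E.
Proof.
move=> pL gL c0 e0; have K0 := rhoD_cst_gt0 q1 q2.
have [cM|Mc] := leP c M; last first.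
  by exists 1 => // m s _ cs sM; move: (le_trans cs sM); rewrite leNgt Mc.
have M0 : 0 <= M by rewrite (le_trans (ltW c0)).
have [C C0 HC] := dev_bound pL gL.
pose a := 2 * K * C / c + 1.
have a0 : 0 < a by rewrite ltr_wpDl// divr_ge0 ?mulr_ge0// ltW.
have [||d [d0 dc Jd]] := @integral_rho_near_small R q1 q2
  q1_gt0 q2_gt0 Q_gt1 Q_lt2 (e / 2 / a) (c / (2 * K)).
- by rewrite !divr_gt0.
- by rewrite divr_gt0// mulr_gt0.
pose b := (1 + K * M) / d + K.
have b0 : 0 < b by rewrite ltr_wpDl// divr_ge0 ?addr_ge0 ?mulr_ge0// ltW.
have [|A A0 HA] := @dev_weight_small L g (e / 2 / b) pL gL; first by rewrite !divr_gt0.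
exists A => // m s Am cs sM; have m0 : 0 < m by rewrite (lt_le_trans A0).
apply: (le_trans (@integral_shifted_kernel_le R q1 q2 q1_gt0 q2_gt0
  (dev L g m) C c M d s _ _ _ C0 c0 cs sM d0 dc)).
- exact: measurable_dev.
- by move=> w; exact: normr_ge0.
- by move=> w w0; exact: HC.
have -> : e%:E = (a%:E * (e / 2 / a)%:E + b%:E * (e / 2 / b)%:E)%E.
  by rewrite -!EFinM -EFinD; congr EFin; field; rewrite !gt_eqF.
apply: leeD; last by rewrite lee_wpmul2l ?lee_fin ?(ltW b0)//; exact: HA.
apply: (@le_trans _ _ (a%:E * \int[leb2 R]_w (rho_near q1 q2 d w)%:E)%E).
  rewrite lee_wpmul2r//; last by rewrite lee_fin /a lerDl.
  by apply: integral_ge0 => w _; rewrite lee_fin rho_near_ge0.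
by rewrite lee_wpmul2l ?lee_fin ?(ltW a0).
Qed.

End deviation.

(** * Summability of the discrete convolution *)

Section convolution.
Context {R : realType}.
Variables (q1 q2 : R) (B : 'M[R]_2).
Hypotheses (q1_gt0 : 0 < q1) (q2_gt0 : 0 < q2) (B_unit : B \in unitmx).
Local Notation Q := (q1^-1 + q2^-1).
Hypotheses (Q_gt1 : 1 < Q) (Q_lt2 : Q < 2).
Local Notation rho := (@rho R q1 q2).
Local Notation dil := (@dilation R q1 q2).
Local Notation K := (rhoD_cst q1 q2).
Local Notation lat := (lattice_point q1 q2 B).
Local Notation a_infty := (a_infty q1 q2).
Local Notation rhoB t := (rho (mulMp B (Z2R t))).
Local Notation dev := (deviation q1 q2 B).
Local Notation plane := (measurableTypeR R * measurableTypeR R)%type.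

Lemma measurable_inv_sqr :
  measurable_fun setT (fun w : plane => ((1 + rho w)^-1 ^+ 2)%:E).
Proof.
by apply/measurable_EFinP; apply: measurable_funX; exact: measurable_1Drho_inv.
Qed.

Lemma integral_inv_sqr_lty :
  (\int[leb2 R]_w ((1 + rho w)^-1 ^+ 2)%:E < +oo)%E.
Proof.
apply: (@le_lt_trans _ _ (\int[leb2 R]_w ((rho_weight q1 q2 w)%:E + ((rho w <= 1)%R%:R)%:E))%E).
  apply: ge0_le_integral => //.
  - by move=> w _; rewrite lee_fin exprn_ge0// invr_ge0 addr_ge0 ?rho_ge0.
  - exact: measurable_inv_sqr.
  - apply: emeasurable_funD; apply/measurable_EFinP; first exact: (@measurable_rho_weight R q1 q2).
    exact: (@measurable_rho_le R q1 q2).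
  - move=> w _; rewrite -EFinD lee_fin.
    have r0 := rho_ge0 q1 q2 w; have r1 : 0 < 1 + rho w by rewrite ltr_pwDl.
    have [w1|w1] := leP (rho w) 1.
      apply: (@le_trans _ _ 1); last by rewrite lerDr rho_weight_ge0.
      by rewrite exprn_ile1 ?invr_ge0 ?(ltW r1)// invf_le1// lerDl.
    rewrite addr0 /rho_weight invfM expr2 ler_wpM2r ?invr_ge0 ?(ltW r1)//.
    have rp : 0 < rho w by rewrite (lt_trans ltr01).
    by rewrite lef_pV2 ?posrE// lerDr.
rewrite ge0_integralD; last 5 first.
- exact: measurableT.
- by move=> w _; rewrite lee_fin rho_weight_ge0.
- by apply/measurable_EFinP; exact: (@measurable_rho_weight R q1 q2).
- by move=> w _; rewrite lee_fin.
- by apply/measurable_EFinP; exact: (@measurable_rho_le R q1 q2).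
rewrite lte_add_pinfty//; first exact: integral_rho_weight_lty.
exact: unit_area_lty.
Qed.

(** 1 + rho (B k) is at most a constant times 1 + rho (B (k + t)), the constant
depending on t. *)
Lemma shift_bound (g : int * int -> R) C t : 0 <= C ->
  (forall k, `|g k| <= C / (1 + rhoB k)) ->
  exists2 C', 0 <= C' & forall k, `|g (k + t)| <= C' / (1 + rhoB k).
Proof.
move=> C0 gC; have K0 := rhoD_cst_gt0 q1 q2; have rt := rho_ge0 q1 q2 (mulMp B (Z2R t)).
exists (C * (1 + K * rhoB t + K)); first by rewrite mulr_ge0// !addr_ge0 ?mulr_ge0// ltW.
move=> k; have rk := rho_ge0 q1 q2 (mulMp B (Z2R k)).
have rkt := rho_ge0 q1 q2 (mulMp B (Z2R (k + t))).
have D0 : 0 < 1 + rhoB (k + t) by rewrite ltr_pwDl.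
have D1 : 0 < 1 + rhoB k by rewrite ltr_pwDl.
rewrite (le_trans (gC _))// ler_pdivrMr// mulrAC ler_pdivlMr// -mulrA ler_wpM2l//.
have := rhoD q1_gt0 q2_gt0 (mulMp B (Z2R (k + t))) (- mulMp B (Z2R t)).
have -> : mulMp B (Z2R (k + t)) - mulMp B (Z2R t) = mulMp B (Z2R k).
  by rewrite /mulMp/Z2R/= !intrD; congr pair => /=; ring.
rewrite rhoN; have := mulr_ge0 (mulr_ge0 (ltW K0) rt) rkt.
move: K0 rt rk rkt; move: (rhoB k) (rhoB t) (rhoB (k + t)) => x y z; nra.
Qed.

(** At scale 1 the terms of the sum are dominated by (1 + rho w)^-2, which is
integrable because Q < 2. *)
Lemma dconv_summable_asymp L1 L2 g1 g2 t :
  profile q1 q2 L1 -> profile q1 q2 L2 -> asymp B q1 q2 L1 g1 -> asymp B q1 q2 L2 g2 ->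
  dconv_summable g1 g2 t.
Proof.
move=> pL1 pL2 gL1 gL2.
have [C1 C10 H1] := asymp_bound q1_gt0 q2_gt0 B_unit pL1 gL1.
have [C2 C20 H2] := asymp_bound q1_gt0 q2_gt0 B_unit pL2 gL2.
have [C3 C30 H3] := shift_bound t C20 H2.
have [D1 D10 {}H1] := lat_bound q1_gt0 q2_gt0 B_unit C10 H1.
have [D2 D20 {H2 H3}H2] := lat_bound q1_gt0 q2_gt0 B_unit C30 H3.
rewrite /dconv_summable /summable (@esum_lat R q1 q2 B B_unit _ 1)//.
rewrite powR1 mul1r lte_mul_pinfty ?lee_fin ?invr_ge0//.
apply: (@le_lt_trans _ _ (\int[leb2 R]_w ((D1 * D2)%:E * ((1 + rho w)^-1 ^+ 2)%:E))%E).
  apply: ge0_le_integral => //.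
  - exact: (measurable_lat_comp q1 q2 B_unit (fun k => `|dconv_term g1 g2 t k|%E) ltr01).
  - by apply: measurable_funeM; exact: measurable_inv_sqr.
  - move=> w _; rewrite /dconv_term/= -EFinM lee_fin normrM.
    have := H1 1 w ltr01; have := H2 1 w ltr01; rewrite mul1r => h2 h1.
    apply: (le_trans (ler_pM _ _ h1 h2)) => //.
    by rewrite mulrACA expr2.
rewrite ge0_integralZl ?lee_fin ?mulr_ge0//; last 2 first.
- exact: measurable_inv_sqr.
- by move=> w _; rewrite lee_fin exprn_ge0// invr_ge0 addr_ge0 ?rho_ge0.
by rewrite lte_mul_pinfty ?lee_fin ?mulr_ge0// integral_inv_sqr_lty.
Qed.

Lemma det_norm_gt0 : 0 < `|\det B|.
Proof. by rewrite normr_gt0; move: B_unit; rewrite unitmxE unitfE. Qed.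

Lemma dconv_integral g1 g2 t m : dconv_summable g1 g2 t -> 0 < m ->
  let f (w : plane) := g1 (lat m w) * g2 (lat m w + t) in
  (leb2 R).-integrable setT (EFin \o f) /\
  dconv g1 g2 t = m `^ Q * `|\det B|^-1 * \int[leb2 R]_w f w.
Proof.
move=> sm m0 f; set c := m `^ Q * `|\det B|^-1.
have c0 : 0 < c by rewrite mulr_gt0 ?powR_gt0// invr_gt0 det_norm_gt0.
have mf : measurable_fun setT f.
  exact: (measurable_lat_comp q1 q2 B_unit (fun k => g1 k * g2 (k + t) : measurableTypeR R) m0).
have int_f : (leb2 R).-integrable setT (EFin \o f).
  apply/integrableP; split; first exact/measurable_EFinP.
  move: sm; rewrite /dconv_summable /summable (@esum_lat R q1 q2 B B_unit _ m)//.
  rewrite -/c => H; rewrite ltey; apply/eqP => fy; move: H.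
  by rewrite /dconv_term/= /f in fy *; rewrite fy mulry gtr0_sg// mul1e.
split => //; rewrite /dconv.
rewrite (@esum_lat R q1 q2 B B_unit _ m)//.
rewrite (@esum_lat R q1 q2 B B_unit _ m)//.
rewrite -/c /Rintegral integralE.
have hp : (EFin \o f)^\+%E = (dconv_term g1 g2 t)^\+%E \o lat m.
  exact: (funepos_comp (dconv_term g1 g2 t) (lat m)).
have hn : (EFin \o f)^\-%E = (dconv_term g1 g2 t)^\-%E \o lat m.
  exact: (funeneg_comp (dconv_term g1 g2 t) (lat m)).
have := integrable_pos_fin_num measurableT int_f.
have := integrable_neg_fin_num measurableT int_f.
rewrite hp hn /=.
case: (\int[leb2 R]_w ((dconv_term g1 g2 t)^\- (lat m w)))%E => // x _.
case: (\int[leb2 R]_w ((dconv_term g1 g2 t)^\+ (lat m w)))%E => // y _.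
by rewrite /= mulrBr.
Qed.

End convolution.

(** * Convergence of the rescaled convolution *)

Section limit.
Context {R : realType}.
Variables (q1 q2 : R) (B : 'M[R]_2).
Hypotheses (q1_gt0 : 0 < q1) (q2_gt0 : 0 < q2) (B_unit : B \in unitmx).
Local Notation Q := (q1^-1 + q2^-1).
Hypotheses (Q_gt1 : 1 < Q) (Q_lt2 : Q < 2).
Local Notation rho := (@rho R q1 q2).
Local Notation dil := (@dilation R q1 q2).
Local Notation K := (rhoD_cst q1 q2).
Local Notation lat := (lattice_point q1 q2 B).
Local Notation a_infty := (a_infty q1 q2).
Local Notation dev := (deviation q1 q2 B).
Local Notation plane := (measurableTypeR R * measurableTypeR R)%type.

Lemma measurable_shift (f : plane -> R) (s : plane) :
  measurable_fun setT f -> measurable_fun setT (fun w : plane => f (w + s)).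
Proof.
move=> mf; have [mt _] := scales_area_translation s.
exact: measurableT_comp mf mt.
Qed.

(** The integrand is dominated by a multiple of 1 / (rho w * rho (w + t)), to which
[integral_shifted_kernel_le] applies with E = 1 / rho. *)
Lemma cconv_integrable_profile L1 L2 (t : R * R) :
  profile q1 q2 L1 -> profile q1 q2 L2 -> t != 0 ->
  cconv_integrable (a_infty L1) (a_infty L2) t.
Proof.
move=> pL1 pL2 t0; have K0 := rhoD_cst_gt0 q1 q2.
have [M1 M10 H1] := a_infty_bound pL1; have [M2 M20 H2] := a_infty_bound pL2.
have m1 := measurable_a_infty pL1; have m2 := measurable_shift t (measurable_a_infty pL2).
have rt := rho_gt0 q1_gt0 q2_gt0 t0.
have mk : measurable_fun setT (fun w : plane => (rho w)^-1 / rho (w + t)).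
  apply: measurable_funM; first exact: measurable_rho_inv.
  exact: (measurable_shift t (@measurable_rho_inv R q1 q2)).
apply/integrableP; split.
  by apply/measurable_EFinP; exact: measurable_funM m1 m2.
apply: (@le_lt_trans _ _ (\int[leb2 R]_w ((M1 * M2)%:E * ((rho w)^-1 / rho (w + t))%:E))%E).
  apply: ge0_le_integral => //.
  - by apply: measurableT_comp => //; apply/measurable_EFinP; exact: measurable_funM m1 m2.
  - by apply: measurable_funeM; exact/measurable_EFinP.
  - move=> w _; rewrite -EFinM /= lee_fin normrM mulrACA.
    exact: ler_pM (normr_ge0 _) (normr_ge0 _) (H1 w) (H2 _).
rewrite ge0_integralZl ?lee_fin ?mulr_ge0//; last 2 first.
- exact/measurable_EFinP.
- by move=> w _; rewrite lee_fin mulr_ge0 ?invr_ge0 ?rho_ge0.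
rewrite lte_mul_pinfty ?lee_fin ?mulr_ge0//.
pose d := rho t / (2 * K).
have d0 : 0 < d by rewrite divr_gt0// mulr_gt0.
apply: (le_lt_trans (@integral_shifted_kernel_le R q1 q2 q1_gt0 q2_gt0
  (fun w => (rho w)^-1) 1 (rho t) (rho t) d t _ _ _ ler01 rt (lexx _) (lexx _) d0 (lexx _))).
- exact: measurable_rho_inv.
- by move=> w; rewrite invr_ge0 rho_ge0.
- by move=> w _; rewrite mul1r.
have -> : (\int[leb2 R]_w ((rho w)^-1 / (1 + rho w))%:E = \int[leb2 R]_w (rho_weight q1 q2 w)%:E)%E.
  by apply: eq_integral => w _; rewrite /rho_weight invfM.
rewrite lte_add_pinfty// lte_mul_pinfty ?lee_fin//.
- by rewrite mulr1 divr_ge0 ?mulr_ge0// ltW.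
- rewrite integral_rho_near// lte_mul_pinfty ?lee_fin ?powR_ge0//.
  exact: integral_rho_near1_lty.
- by rewrite addr_ge0 ?divr_ge0 ?addr_ge0 ?mulr_ge0// ltW.
- exact: integral_rho_weight_lty.
Qed.

Lemma normr_Rintegral_le (f : plane -> R) e :
  (leb2 R).-integrable setT (EFin \o f) ->
  (\int[leb2 R]_w (`|f w|)%:E <= e%:E)%E -> `|\int[leb2 R]_w f w| <= e.
Proof.
move=> intf fe; apply: le_trans (le_normr_Rintegral measurableT intf) _.
rewrite /Rintegral; move: fe.
have : (0 <= \int[leb2 R]_w (`|f w|)%:E)%E by apply: integral_ge0 => w _; rewrite lee_fin.
by case: (\int[leb2 R]_w _)%E => // r _; rewrite lee_fin.
Qed.

(** The difference of the integrands is split as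
G1 G2 - a1 a2 = (G1 - a1) G2 + a1 (G2 - a2); the second part is brought to the
form treated by [dev_shift_small] by translating the variable by s. *)
Lemma rescaled_conv_cvg L1 L2 g1 g2 c M e :
  profile q1 q2 L1 -> profile q1 q2 L2 -> asymp B q1 q2 L1 g1 -> asymp B q1 q2 L2 g2 ->
  0 < c -> 0 < e ->
  exists2 A, 0 < A & forall m (s : R * R), A <= m -> c <= rho s -> rho s <= M ->
    (leb2 R).-integrable setT
      (fun w => (m * g1 (lat m w) * (m * g2 (lat m (w + s))))%:E) ->
    `|\int[leb2 R]_w (m * g1 (lat m w) * (m * g2 (lat m (w + s)))) -
      cconv (a_infty L1) (a_infty L2) s| <= e.
Proof.
move=> pL1 pL2 gL1 gL2 c0 e0.
have [C C0 HC] := rescaled_bound q1_gt0 q2_gt0 B_unit pL2 gL2.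
have [M1 M10 HM1] := a_infty_bound pL1.
have C1 : 0 < C + 1 by rewrite ltr_wpDl.
have M11 : 0 < M1 + 1 by rewrite ltr_wpDl.
have [|A1 A10 HA1] := @dev_shift_small R q1 q2 B q1_gt0 q2_gt0 B_unit Q_gt1 Q_lt2
  L1 g1 c M (e / 2 / (C + 1)) pL1 gL1 c0; first by rewrite !divr_gt0.
have [|A2 A20 HA2] := @dev_shift_small R q1 q2 B q1_gt0 q2_gt0 B_unit Q_gt1 Q_lt2
  L2 g2 c M (e / 2 / (M1 + 1)) pL2 gL2 c0; first by rewrite !divr_gt0.
exists (Num.max A1 A2); first by rewrite lt_max A10.
move=> m s; rewrite ge_max => /andP[mA1 mA2] cs sM intH.
have m0 : 0 < m by rewrite (lt_le_trans A10).
have s0 : s != 0 by apply: contraTneq cs => ->; rewrite rho0// -ltNge.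
have inta := cconv_integrable_profile pL1 pL2 s0.
have md1 := @measurable_dev R q1 q2 B B_unit L1 g1 m pL1 m0.
have md2 := @measurable_dev R q1 q2 B B_unit L2 g2 m pL2 m0.
have mr1 : measurable_fun setT (fun w : plane => dev L1 g1 m w / rho (w + s)).
  by apply: measurable_funM => //; exact: (measurable_shift s (@measurable_rho_inv R q1 q2)).
have mr2 : measurable_fun setT (fun w : plane => dev L2 g2 m w / rho (w + - s)).
  by apply: measurable_funM => //; exact: (measurable_shift (- s) (@measurable_rho_inv R q1 q2)).
have mr3 : measurable_fun setT (fun w : plane => dev L2 g2 m (w + s) / rho w).
  by apply: measurable_funM; [exact: (measurable_shift s md2)|exact: measurable_rho_inv].
rewrite /cconv -(RintegralB measurableT intH inta).
pose H (w : plane) : R := m * g1 (lat m w) * (m * g2 (lat m (w + s))).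
pose F (w : plane) : R := a_infty L1 w * a_infty L2 (w + s).
have intD : (leb2 R).-integrable setT (EFin \o (fun w => H w - F w)).
  have -> : EFin \o (fun w => H w - F w) = ((EFin \o H) \- (EFin \o F))%E.
    by apply/funext => w; rewrite /= EFinB.
  exact: integrableB.
apply: normr_Rintegral_le; first exact: intD.
apply: (@le_trans _ _ (\int[leb2 R]_w
   (C%:E * (dev L1 g1 m w / rho (w + s))%:E + M1%:E * (dev L2 g2 m (w + s) / rho w)%:E))%E).
  apply: ae_ge0_le_integral.
  - exact: measurableT.
  - by move=> w _; rewrite lee_fin.
  - apply/measurable_EFinP; apply: measurableT_comp; first exact: normr_measurable.
    by apply/measurable_EFinP; exact: (measurable_int _ intD).
  - by move=> w _; rewrite -!EFinM -EFinD lee_fin addr_ge0// mulr_ge0// divr_ge0 ?normr_ge0 ?rho_ge0.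
  - by apply: emeasurable_funD; apply: measurable_funeM; exact/measurable_EFinP.
  (* The bound C / rho (w + s) on the second factor holds for w + s != 0. *)
  - apply: filterS (ae_neq (- s : plane)) => w ws _.
    rewrite -!EFinM -EFinD lee_fin.
    have ws0 : w + s != 0 by rewrite addr_eq0.
    have -> : m * g1 (lat m w) * (m * g2 (lat m (w + s))) - a_infty L1 w * a_infty L2 (w + s) =
      (m * g1 (lat m w) - a_infty L1 w) * (m * g2 (lat m (w + s))) +
      a_infty L1 w * (m * g2 (lat m (w + s)) - a_infty L2 (w + s)) by ring.
    rewrite (le_trans (ler_normD _ _))//; apply: lerD.
      by rewrite normrM [leRHS]mulrCA ler_wpM2l//; exact: HC.
    by rewrite normrM [leRHS]mulrCA [leLHS]mulrC ler_wpM2l//; exact: HM1.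
rewrite ge0_integralD; last 5 first.
- exact: measurableT.
- by move=> w _; rewrite -EFinM lee_fin mulr_ge0// divr_ge0 ?normr_ge0 ?rho_ge0.
- by apply: measurable_funeM; exact/measurable_EFinP.
- by move=> w _; rewrite -EFinM lee_fin mulr_ge0// divr_ge0 ?normr_ge0 ?rho_ge0.
- by apply: measurable_funeM; exact/measurable_EFinP.
rewrite ge0_integralZl ?lee_fin//; last 2 first.
- exact/measurable_EFinP.
- by move=> w _; rewrite lee_fin divr_ge0 ?normr_ge0 ?rho_ge0.
rewrite ge0_integralZl ?lee_fin//; last 2 first.
- exact/measurable_EFinP.
- by move=> w _; rewrite lee_fin divr_ge0 ?normr_ge0 ?rho_ge0.
have -> : (\int[leb2 R]_w (dev L2 g2 m (w + s) / rho w)%:E =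
           \int[leb2 R]_w (dev L2 g2 m w / rho (w + - s))%:E)%E.
  have [_ T] := scales_area_translation (s : plane).
  rewrite -(T (fun w => (dev L2 g2 m w / rho (w + - s))%:E)); last 2 first.
  - exact/measurable_EFinP.
  - by move=> w; rewrite lee_fin divr_ge0 ?normr_ge0 ?rho_ge0.
  by rewrite mul1e; apply: eq_integral => w _; rewrite addrK.
have -> : e%:E = ((C + 1)%:E * (e / 2 / (C + 1))%:E + (M1 + 1)%:E * (e / 2 / (M1 + 1))%:E)%E.
  by rewrite -!EFinM -EFinD; congr EFin; field; rewrite !gt_eqF.
apply: leeD.
- apply: lee_pmul; rewrite ?lee_fin ?lerDl//.
    by apply: integral_ge0 => w _; rewrite lee_fin divr_ge0 ?normr_ge0 ?rho_ge0.
  exact: HA1.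
- apply: lee_pmul; rewrite ?lee_fin ?lerDl//.
    by apply: integral_ge0 => w _; rewrite lee_fin divr_ge0 ?normr_ge0 ?rho_ge0.
  by apply: HA2; rewrite ?rhoN.
Qed.

End limit.

(** * Invariance and positivity of the limit *)

Section main.
Context {R : realType}.
Variables (q1 q2 : R).
Hypotheses (q1_gt0 : 0 < q1) (q2_gt0 : 0 < q2).
Local Notation Q := (q1^-1 + q2^-1).
Local Notation rho := (@rho R q1 q2).
Local Notation dil := (@dilation R q1 q2).
Local Notation a_infty := (a_infty q1 q2).
Local Notation plane := (measurableTypeR R * measurableTypeR R)%type.

Lemma Ltilde_dil B (a1 a2 : R * R -> R) lam t : 0 < lam ->
  Ltilde B q1 q2 a1 a2 (dil lam t) = Ltilde B q1 q2 a1 a2 t.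
Proof.
move=> lam0; rewrite /Ltilde (rho_dil q1_gt0 q2_gt0 _ (ltW lam0)).
have powE p : (lam * rho t) `^ p = lam `^ p * rho t `^ p.
  exact: powRM _ (ltW lam0) (rho_ge0 q1 q2 t).
have cancel (c x y : R) : 0 < c -> (c * x) / (c * y) = x / y.
  by move=> c0; rewrite -mulf_div divff ?mul1r// gt_eqF.
by rewrite 2!powE /= 2?cancel ?powR_gt0.
Qed.

Lemma generalized_invariant_Ltilde B (a1 a2 : R * R -> R) :
  generalized_invariant q1 q2 (Ltilde B q1 q2 a1 a2).
Proof.
move=> t _ lam mu lam0 mu0.
rewrite -[LHS]/(Ltilde B q1 q2 a1 a2 (dil lam t)).
by rewrite -[RHS]/(Ltilde B q1 q2 a1 a2 (dil mu t)) !Ltilde_dil.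
Qed.

Lemma a_infty_ge0 L : (forall u : R * R, u != 0 -> 0 <= L u) -> forall u, 0 <= a_infty L u.
Proof.
move=> L0 u; have [->|u0] := eqVneq u 0; first by rewrite /Defs.a_infty rho0// invr0 mul0r.
by rewrite mulr_ge0 ?invr_ge0 ?rho_ge0 ?L0.
Qed.

(** On a small square around [p] the function exceeds half of its value at [p]. *)
Lemma integral_gt0_of_continuous (f : R * R -> R) (p : R * R) :
  (leb2 R).-integrable setT (EFin \o f : plane -> \bar R) -> (forall w, 0 <= f w) ->
  {for p, continuous f} -> 0 < f p -> 0 < \int[leb2 R]_w f w.
Proof.
move=> intf f0 cf fp.
have : \forall w \near p, f p / 2 < f w.
  by apply: (cvgr_gt _ cf); rewrite ltr_pdivrMr// ltr_pMr// ltr1n.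
move=> /nbhs_ballP[e /= e0 He].
pose S : set plane :=
  (ball p.1 e : set (measurableTypeR R)) `*` (ball p.2 e : set (measurableTypeR R)).
have mb (x : R) : measurable (ball x e : set (measurableTypeR R)) by exact: measurable_ball.
have mS : measurable S by exact: measurableX.
have bE (x : R) : leb R (ball x e : set (measurableTypeR R)) = (e *+ 2)%:E.
  exact: lebesgue_measure_ball (ltW e0).
have SE : leb2 R S = (e *+ 2 * e *+ 2)%:E.
  by rewrite (lebesgue2_rect (mb _) (mb _)) !bE -EFinM mulrnAr.
have fp2 : 0 <= f p / 2 by rewrite divr_ge0 ?(ltW fp).
have ge : ((f p / 2)%:E * leb2 R S <= \int[leb2 R]_w (f w)%:E)%E.
  have <- : (\int[leb2 R]_w (\1_S w)%:E = leb2 R S)%E by rewrite integral_indic// setIT.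
  rewrite -ge0_integralZl//; last by apply/measurable_EFinP; exact: measurable_indic.
  apply: ge0_le_integral => //.
  - by move=> w _; rewrite -EFinM lee_fin mulr_ge0.
  - by apply: measurable_funeM; apply/measurable_EFinP; exact: measurable_indic.
  - exact: (measurable_int _ intf).
  - move=> w _; rewrite -EFinM lee_fin indicE.
    have [wS|wS] := boolP (w \in S); last by rewrite mulr0.
    by rewrite mulr1 ltW//; apply: He; move: wS; rewrite inE => -[].
have gt0 : (0 < \int[leb2 R]_w (f w)%:E)%E.
  apply: lt_le_trans ge; rewrite SE -EFinM lte_fin !mulr_gt0//.
  by rewrite pmulrn_lgt0// mulr_gt0// pmulrn_lgt0.
have := integrable_fin_num measurableT intf.
rewrite /Rintegral; move: gt0 => /=.
by case: (\int[leb2 R]_w (f w)%:E)%E => // r; rewrite lte_fin.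
Qed.

(** If L is positive at u, then the integrand is positive at dil m u for m large:
dil m u + s = dil m (u + dil m^-1 s), and dil m^-1 s tends to 0. *)
Lemma cconv_gt0 L1 L2 s : profile q1 q2 L1 -> profile q1 q2 L2 -> s != 0 ->
  (forall u : R * R, u != 0 -> 0 <= L1 u) -> (forall u : R * R, u != 0 -> L1 u = L2 u) ->
  (exists2 u : R * R, u != 0 & L1 u != 0) ->
  cconv_integrable (a_infty L1) (a_infty L2) s ->
  0 < cconv (a_infty L1) (a_infty L2) s.
Proof.
move=> pL1 pL2 s0 L10 L12 [u u0 Lu] ints.
have L1u : 0 < L1 u by rewrite lt_neqAle eq_sym Lu L10.
have L20 v : v != 0 -> 0 <= L2 v by move=> v0; rewrite -L12// L10.
have rs := rho_gt0 q1_gt0 q2_gt0 s0.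
have nu : \forall v \near u, 0 < L2 v /\ 0 < rho v.
  apply: filterI.
    have c2 : L2 v @[v --> u] --> L2 u := profile_continuous pL2 u0.
    by apply: (cvgr_gt _ c2); rewrite -L12.
  have cr : rho v @[v --> u] --> rho u by exact: rho_continuous.
  by apply: (cvgr_gt _ cr); exact: rho_gt0.
have [d d0 Hd] := near_rho q1_gt0 q2_gt0 nu.
(* Large enough for rho (dil m^-1 s) = rho s / m to be less than d. *)
pose m := rho s / d + 1.
have m0 : 0 < m by rewrite ltr_wpDl// divr_ge0 ?rho_ge0 ?(ltW d0).
pose v := u + dil m^-1 s.
have [L2v rv] : 0 < L2 v /\ 0 < rho v.
  apply: Hd; rewrite /v addrAC subrr add0r (rho_dil q1_gt0 q2_gt0) ?invr_ge0 ?(ltW m0)//.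
  by rewrite mulrC ltr_pdivrMr// mulrC -ltr_pdivrMr// /m ltrDl.
pose p := dil m u.
have pE : p + s = dil m v by rewrite /p /v dilD dilVK.
have rho0N w : 0 < rho w -> w != 0.
  by apply: contraTneq => ->; rewrite rho0// ltxx.
have rp : 0 < rho p by rewrite (rho_dil q1_gt0 q2_gt0 _ (ltW m0)) mulr_gt0// rho_gt0.
have rps : 0 < rho (p + s) by rewrite pE (rho_dil q1_gt0 q2_gt0 _ (ltW m0)) mulr_gt0.
apply: (@integral_gt0_of_continuous (fun w => a_infty L1 w * a_infty L2 (w + s)) p).
- exact: ints.
- by move=> w; rewrite mulr_ge0 ?a_infty_ge0.
- apply: cvgM; first exact: (a_infty_continuous q1_gt0 q2_gt0 pL1 (rho0N _ rp)).
  have : {for p, continuous (a_infty L2 \o (fun w : R * R => w + s))}.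
    apply: continuous_comp; last exact: (a_infty_continuous q1_gt0 q2_gt0 pL2 (rho0N _ rps)).
    by apply: cvgD; [exact: cvg_id|exact: cvg_cst].
  exact.
- rewrite mulr_gt0 ?mulr_gt0 ?invr_gt0//.
    by rewrite /p (profile_dil pL1).
  by rewrite pE (profile_dil pL2).
Qed.

End main.

(** * Asymptotics of the discrete convolution *)

Section asymptotics.
Context {R : realType}.
Variables (q1 q2 : R) (B : 'M[R]_2).
Hypotheses (q1_gt0 : 0 < q1) (q2_gt0 : 0 < q2) (B_unit : B \in unitmx).
Local Notation Q := (q1^-1 + q2^-1).
Hypotheses (Q_gt1 : 1 < Q) (Q_lt2 : Q < 2).
Local Notation p := (2 - Q).
Local Notation rho := (@rho R q1 q2).
Local Notation rho' := (@Defs.rho R (q1 * p) (q2 * p)).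
Local Notation dil := (@dilation R q1 q2).
Local Notation a_infty := (a_infty q1 q2).

Let p_gt0 : 0 < p. Proof. by rewrite subr_gt0. Qed.

(** The normalization used in the definition of [Ltilde] is the inverse of the
dilation at scale m = lam^(1/(2-Q)). *)
Lemma dilV_powR lam x : 0 < lam ->
  dil (lam `^ p^-1)^-1 x = (x.1 / lam `^ (q1 * p)^-1, x.2 / lam `^ (q2 * p)^-1).
Proof.
move=> lam0.
have e q : (lam `^ p^-1)^-1 `^ q^-1 = (lam `^ (q * p)^-1)^-1.
  by rewrite powRV ?powR_ge0// -powRrM invfM mulrC.
by rewrite /dilation !e; congr pair; rewrite mulrC.
Qed.

Lemma rho'_normalized x : x != 0 ->
  rho' (dil (rho' x `^ p^-1)^-1 x) = 1.
Proof.
move=> x0.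
have q1' : 0 < q1 * p by rewrite mulr_gt0.
have q2' : 0 < q2 * p by rewrite mulr_gt0.
have r0 := rho_gt0 q1' q2' x0.
rewrite dilV_powR//.
have -> : (x.1 / rho' x `^ (q1 * p)^-1, x.2 / rho' x `^ (q2 * p)^-1) =
    dilation (q1 * p) (q2 * p) (rho' x)^-1 x.
  by rewrite /dilation !(powRV _ (ltW r0)); congr pair; rewrite mulrC.
by rewrite (rho_dil q1' q2') ?invr_ge0 ?(ltW r0)// mulVf// gt_eqF.
Qed.

(** The curve rho~ = 1 is bounded and stays away from the origin. *)
Lemma rho_of_rho' s : rho' s = 1 -> 2^-1 `^ p^-1 <= rho s <= 2.
Proof.
rewrite /Defs.rho !powRrM; set x := `|s.1| `^ q1; set y := `|s.2| `^ q2 => h.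
have x0 : 0 <= x by exact: powR_ge0.
have y0 : 0 <= y by exact: powR_ge0.
clearbody x y.
apply/andP; split; last first.
  have -> : 2 = 1 + 1 :> R by [].
  have hx : x `^ p <= 1 by rewrite -[leRHS]h lerDl powR_ge0.
  have hy : y `^ p <= 1 by rewrite -[leRHS]h lerDr powR_ge0.
  exact: lerD (powR_le1 p_gt0 x0 hx) (powR_le1 p_gt0 y0 hy).
(* Of two numbers that add up to 1, one is at least 1/2. *)
have big (z : R) : 0 <= z -> 2^-1 <= z `^ p -> 2^-1 `^ p^-1 <= z.
  move=> z0 hz; rewrite -[leRHS](powR_invK p_gt0 z0).
  have pV0 : 0 <= p^-1 by rewrite invr_ge0 ltW.
  by rewrite (ge0_ler_powR pV0) ?nnegrE ?powR_ge0// invr_ge0.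
have [hx|hx] := leP 2^-1 (x `^ p).
  by rewrite (le_trans (big _ x0 hx))// lerDl.
have hy : 2^-1 <= y `^ p by lra.
by rewrite (le_trans (big _ y0 hy))// lerDr.
Qed.

(** This is [rescaled_conv_cvg] at the scale m = rho~ (B t)^(1/(2-Q)), which tends to
infinity with |t|, and at the point s = dil m^-1 (B t) of the curve rho~ = 1. *)
Lemma dconv_asymp L1 L2 g1 g2 :
  profile q1 q2 L1 -> profile q1 q2 L2 -> asymp B q1 q2 L1 g1 -> asymp B q1 q2 L2 g2 ->
  asymp B (q1 * p) (q2 * p)
    (Ltilde B (q1 * p) (q2 * p) (a_infty L1) (a_infty L2)) (dconv g1 g2).
Proof.
move=> pL1 pL2 gL1 gL2.
have q1' : 0 < q1 * p by rewrite mulr_gt0.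
have q2' : 0 < q2 * p by rewrite mulr_gt0.
set L' := Ltilde _ _ _ _ _.
pose x t := mulMp B (Z2R t).
exists (fun t => rho' (x t) * dconv g1 g2 t - L' (x t)); last first.
  have := @rhoB_gt_near R (q1 * p) (q2 * p) B q1' q2' B_unit 0.
  apply: filterS => t t0; rewrite addrCA subrr addr0 mulrA mulVf ?mul1r//.
  by rewrite gt_eqF.
have D0 := det_norm_gt0 B_unit.
apply/cvgrPdist_le => e e0.
have c0 : 0 < 2^-1 `^ p^-1 :> R by rewrite powR_gt0.
have [|A A0 HA] := @rescaled_conv_cvg R q1 q2 B q1_gt0 q2_gt0 B_unit Q_gt1 Q_lt2
  L1 L2 g1 g2 (2^-1 `^ p^-1) 2 (`|\det B| * e) pL1 pL2 gL1 gL2 c0; first by rewrite mulr_gt0.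
have := @rhoB_gt_near R (q1 * p) (q2 * p) B q1' q2' B_unit (A `^ p).
apply: filterS => t; rewrite -/(x t) => At.
have lam0 : 0 < rho' (x t) by rewrite (le_lt_trans _ At)// powR_ge0.
set lam := rho' (x t) in At lam0 *.
pose m := lam `^ p^-1.
have m0 : 0 < m by rewrite powR_gt0.
have Am : A <= m.
  rewrite -[A](powR_invK p_gt0 (ltW A0)) /m.
  have pV0 : 0 <= p^-1 by rewrite invr_ge0 ltW.
  by rewrite (ge0_ler_powR pV0) ?nnegrE ?powR_ge0 ?(ltW lam0) ?(ltW At).
pose s := dil m^-1 (x t).
have xt0 : x t != 0 by apply: contraTneq lam0 => xt0; rewrite /lam xt0 rho0// ltxx.
have /rho_of_rho'/andP[cs s2] : rho' s = 1 by exact: rho'_normalized.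
have sm := dconv_summable_asymp q1_gt0 q2_gt0 B_unit Q_gt1 Q_lt2 t pL1 pL2 gL1 gL2.
have [intf dE] := dconv_integral q1 q2 B_unit sm m0.
have HE : (fun w : measurableTypeR R * measurableTypeR R =>
    m * g1 (lattice_point q1 q2 B m w) * (m * g2 (lattice_point q1 q2 B m (w + s)))) =
    (fun w => m ^+ 2 * (g1 (lattice_point q1 q2 B m w) * g2 (lattice_point q1 q2 B m w + t))).
  by apply/funext => w; rewrite /s lat_shift// expr2 mulrACA.
have intH : (leb2 R).-integrable setT
    (fun w => (m * g1 (lattice_point q1 q2 B m w) * (m * g2 (lattice_point q1 q2 B m (w + s))))%:E).
  have -> : (fun w : measurableTypeR R * measurableTypeR R =>
     (m * g1 (lattice_point q1 q2 B m w) * (m * g2 (lattice_point q1 q2 B m (w + s))))%:E) =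
     (fun w => (m ^+ 2)%:E * (g1 (lattice_point q1 q2 B m w) * g2 (lattice_point q1 q2 B m w + t))%:E)%E.
    by apply/funext => w; rewrite -EFinM; congr EFin; exact: (congr1 (@^~ w) HE).
  by apply: integrableZl => //; exact: intf.
have := HA m s Am cs s2 intH.
rewrite HE RintegralZl// => Hd.
have -> : lam * dconv g1 g2 t = `|\det B|^-1 *
    (m ^+ 2 * \int[leb2 R]_w (g1 (lattice_point q1 q2 B m w) * g2 (lattice_point q1 q2 B m w + t))).
  rewrite dE.
  have -> : lam = m `^ p by rewrite /m -powRrM mulVf ?gt_eqF// powRr1 ?ltW.
  rewrite -powR_mulrn ?(ltW m0)//.
  (* lam = m^p times the area factor m^Q leaves a factor m for each of g1, g2. *)
  have -> : m `^ 2%:R = m `^ p * m `^ Q.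
    by rewrite -powRD ?subrK// (gt_eqF m0) implybT.
  by ring.
have -> : L' (x t) = `|\det B|^-1 * cconv (a_infty L1) (a_infty L2) s.
  by rewrite /L' /Ltilde -/lam /s /m dilV_powR.
rewrite sub0r normrN -mulrBr normrM normfV normr_id mulrC ler_pdivrMr//.
by rewrite [leRHS]mulrC.
Qed.

End asymptotics.

Unset Implicit Arguments.

Theorem proposition4p5 (R : realType) (q1 q2 : R) (B : 'M[R]_2)
    (g1 g2 : int * int -> R) (L1p L1m L2p L2m : R -> R) :
  let Q := q1^-1 + q2^-1 in
  let L1 := angular q1 q2 L1p L1m in
  let L2 := angular q1 q2 L2p L2m in
  let a1 := a_infty q1 q2 L1 in
  let a2 := a_infty q1 q2 L2 in
  let q1' := q1 * (2 - Q) in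
  let q2' := q2 * (2 - Q) in
  let L' := Ltilde B q1' q2' a1 a2 in
  0 < q1 -> 0 < q2 -> 1 < Q -> Q < 2 ->
  B \in unitmx ->
  angular_pair L1p L1m -> angular_pair L2p L2m ->
  asymp B q1 q2 L1 g1 -> asymp B q1 q2 L2 g2 ->
  [/\ forall t : int * int, dconv_summable g1 g2 t,
      forall t : R * R, t != 0 -> cconv_integrable a1 a2 t,
      asymp B q1' q2' L' (dconv g1 g2),
      generalized_invariant q1' q2' L' &
      (forall u : R * R, u != 0 -> L1 u = L2 u) ->
      (forall u : R * R, u != 0 -> 0 <= L1 u) ->
      (exists2 u : R * R, u != 0 & L1 u != 0) ->
      forall t : R * R, t != 0 -> 0 < L' t].
Proof.
move=> Q L1 L2 a1 a2 q1' q2' L' q1_gt0 q2_gt0 Q_gt1 Q_lt2 B_unit A1 A2 gL1 gL2.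
have pL1 : profile q1 q2 L1 by exact: angular_profile.
have pL2 : profile q1 q2 L2 by exact: angular_profile.
have p_gt0 : 0 < 2 - Q by rewrite subr_gt0.
have q1'_gt0 : 0 < q1' by rewrite mulr_gt0.
have q2'_gt0 : 0 < q2' by rewrite mulr_gt0.
split.
- by move=> t; exact: (dconv_summable_asymp q1_gt0 q2_gt0 B_unit Q_gt1 Q_lt2 t pL1 pL2 gL1 gL2).
- by move=> t t0; exact: cconv_integrable_profile.
- exact: (dconv_asymp q1_gt0 q2_gt0 B_unit Q_gt1 Q_lt2 pL1 pL2 gL1 gL2).
- exact: generalized_invariant_Ltilde.
- move=> L12 L1_ge0 L1_neq0 t t0.
  have r0 := rho_gt0 q1'_gt0 q2'_gt0 t0.
  rewrite mulr_gt0 ?invr_gt0 ?det_norm_gt0// -dilV_powR//.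
  set s := dilation _ _ _ _.
  have s0 : s != 0.
    apply/eqP => s0; have := rho'_normalized q1_gt0 q2_gt0 Q_lt2 t0.
    by rewrite -/s s0 rho0// => /esym/eqP; rewrite oner_eq0.
  by apply: cconv_gt0 => //; exact: cconv_integrable_profile.
Qed.
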